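(* Let $A\in\mathbb{C}^{n\times n}$ and let $B_1,B_2,C_1,C_2,D_{11},D_{12},D_{21}$ be matrices of compatible sizes defining the discrete-time plant $$x_{j+1}=Ax_j+B_1w_j+B_2u_j,\quad z_j=C_1x_j+D_{11}w_j+D_{12}u_j,\quad y_j=C_2x_j+D_{21}w_j,$$ with $w_j\in\mathbb{C}^m$, and assume $(A,B_2,C_2)$ is stabilizable in the sense that there is at least one controller $(A_K,B_K,C_K,D_K)$ with $\rho(A_{cl})<1$. Let $k\ge1$ be an integer and let the controller order $n_K$ (the size of $A_K$) be greater than or equal to the plant order $n$. Then the synthesis problem (S) defined in the context is solved by the following two semidefinite programs, solved one after the other. (1) First semidefinite program (PQ): minimize $\lambda+k\,t$ over Hermitian $P,Q\in\mathbb{C}^{n\times n}$, $Y=Y^*\in\mathbb{C}^{m\times m}$, $\lambda\ge0$, $t\ge0$ subject to $|Y|\le t\mathbf{1}\mathbf{1}^\top$, $$\begin{bmatrix} P & I_n \\ I_n & Q \end{bmatrix}\succ0,$$ $$\Pi_c^*\begin{bmatrix} AQA^*-Q & AQC_1^* & B_1 \\ C_1QA^* & C_1QC_1^*-I & D_{11} \\ B_1^* & D_{11}^* & -\lambda I-Y \end{bmatrix}\Pi_c\prec0,$$ $$\Pi_o^*\begin{bmatrix} A^*PA-P & A^*PB_1 & C_1^* \\ B_1^*PA & B_1^*PB_1-\lambda I-Y & D_{11}^* \\ C_1 & D_{11} & -I \end{bmatrix}\Pi_o\prec0.$$ (2) After obtaining $P,Q$ by solving (PQ), construct $P_{cl}=\begin{bmatrix}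 P & P_2^* \\ P_2 & I \end{bmatrix}$, where $P_2$ is given by $P-Q^{-1}=P_2^*P_2$. With this $P_{cl}$ fixed, the second semidefinite program is: minimize $\lambda+k\,t$ over $A_K,B_K,C_K,D_K,Y,\lambda,t$ subject to $|Y|\le t\mathbf{1}\mathbf{1}^\top$, $Y=Y^*$, $t\ge0$, $\lambda\ge0$ and $$\begin{bmatrix} P_{cl}^{-1} & 0 & A_{cl} & B_{cl} \\ 0 & I & C_{cl} & D_{cl} \\ A_{cl}^* & C_{cl}^* & P_{cl} & 0 \\ B_{cl}^* & D_{cl}^* & 0 & \lambda I+Y \end{bmatrix}\succ0.$$ This second program returns a controller $(A_K,B_K,C_K,D_K)$ that achieves the optimal value of (PQ).
   Context: Here $\rho$ is the spectral radius, $|Y|$ is the entrywise absolute value, $|Y|\le t\mathbf{1}\mathbf{1}^\top$ is an entrywise inequality, $\mathbf{1}$ is the all-ones vector, ${}^*$ is conjugate transpose, and $\succ,\prec$ refer to positive/negative definiteness of Hermitian matrices. A controller of order $n_K$ is $\zeta_{j+1}=A_K\zeta_j+B_Ky_j$, $u_j=C_K\zeta_j+D_Ky_j$ with $A_K$ of size $n_K\times n_K$. The closed-loop matrices are $$A_{cl}=\begin{bmatrix} A+B_2D_KC_2 & B_2C_K \\ B_KC_2 & A_K \end{bmatrix},\quad B_{cl}=\begin{bmatrix} B_1+B_2D_KD_{21} \\ B_KD_{21} \end{bmatrix},$$ $$C_{cl}=\begin{bmatrix} C_1+D_{12}D_KC_2 & D_{12}C_K \end{bmatrix},\quad D_{cl}=D_{11}+D_{12}D_KD_{21}.$$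 Synthesis problem (S): minimize $\lambda+k\,t$ over $A_K,B_K,C_K,D_K,P_{cl},Y,\lambda,t$ subject to $P_{cl}\succ0$, $Y=Y^*$, $|Y|\le t\mathbf{1}\mathbf{1}^\top$, $t\ge0$, $\lambda\ge0$ and $$\begin{bmatrix} A_{cl}^*P_{cl}A_{cl}-P_{cl} & A_{cl}^*P_{cl}B_{cl} \\ B_{cl}^*P_{cl}A_{cl} & B_{cl}^*P_{cl}B_{cl}-\lambda I-Y \end{bmatrix}+\begin{bmatrix} C_{cl}^*C_{cl} & C_{cl}^*D_{cl} \\ D_{cl}^*C_{cl} & D_{cl}^*D_{cl} \end{bmatrix}\prec0.$$ The matrices $\Pi_c,\Pi_o$ are $$\Pi_c=\begin{bmatrix} N_c & 0 \\ 0 & I \end{bmatrix},\qquad \Pi_o=\begin{bmatrix} N_o & 0 \\ 0 & I \end{bmatrix},$$ where $N_c^*N_c=I$, $N_o^*N_o=I$, $\mathrm{Range}(N_c)=\mathrm{Ker}\begin{bmatrix} B_2^* & D_{12}^* \end{bmatrix}$ and $\mathrm{Range}(N_o)=\mathrm{Ker}\begin{bmatrix} C_2 & D_{21} \end{bmatrix}$. *)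

(* Defs.v *)
From mathcomp Require Import all_boot all_order all_algebra.
From mathcomp Require Import complex.
From mathcomp Require Import boolp classical_sets reals.

Set Implicit Arguments.
Unset Strict Implicit.
Unset Printing Implicit Defensive.

Import Order.TTheory GRing.Theory Num.Theory.

Local Open Scope ring_scope.
Local Open Scope complex_scope.
Local Open Scope sesquilinear_scope.
Local Open Scope classical_set_scope.

(* The order of [R[i]] is partial: [0 < z] says that [z] is real and positive. *)
Definition posdefmx (R : realType) (n : nat) (M : 'M[R[i]]_n) : Prop :=
  M \is hermsymmx /\
  forall v : 'cV[R[i]]_n, v != 0 -> 0 < (v^t* *m M *m v) 0 0.

Definition negdefmx (R : realType) (n : nat) (M : 'M[R[i]]_n) : Prop :=
  M \is hermsymmx /\
  forall v : 'cV[R[i]]_n, v != 0 -> (v^t* *m M *m v) 0 0 < 0.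

(* The set of moduli is finite, so [sup] is a maximum; it is 0 when n = 0. *)
Definition spectral_radius (R : realType) (n : nat) (M : 'M[R[i]]_n) : R :=
  sup [set ComplexField.Normc.normc a | a in [set a : R[i] | eigenvalue M a]].

Definition orthonormal_kernel (R : realType) (q d r : nat)
    (M : 'M[R[i]]_(q, d)) (N : 'M[R[i]]_(d, r)) : Prop :=
  N^t* *m N = 1%:M /\
  forall v : 'cV[R[i]]_d, (exists w : 'cV[R[i]]_r, v = N *m w) <-> M *m v = 0.

Definition block_mx3 (T : Type) (a1 a2 a3 b1 b2 b3 : nat)
    (M11 : 'M[T]_(a1, b1)) (M12 : 'M[T]_(a1, b2)) (M13 : 'M[T]_(a1, b3))
    (M21 : 'M[T]_(a2, b1)) (M22 : 'M[T]_(a2, b2)) (M23 : 'M[T]_(a2, b3))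
    (M31 : 'M[T]_(a3, b1)) (M32 : 'M[T]_(a3, b2)) (M33 : 'M[T]_(a3, b3)) :
    'M[T]_(a1 + a2 + a3, b1 + b2 + b3) :=
  block_mx (block_mx M11 M12 M21 M22) (col_mx M13 M23)
           (row_mx M31 M32) M33.

(* Dimensions: n state, m disturbance w, p performance output z, nu input u,
   ny measurement y, nK controller state. *)
Record plant (R : realType) (n m p nu ny : nat) := Plant {
  plA : 'M[R[i]]_n;
  plB1 : 'M[R[i]]_(n, m);
  plB2 : 'M[R[i]]_(n, nu);
  plC1 : 'M[R[i]]_(p, n);
  plC2 : 'M[R[i]]_(ny, n);
  plD11 : 'M[R[i]]_(p, m);
  plD12 : 'M[R[i]]_(p, nu);
  plD21 : 'M[R[i]]_(ny, m)
}.

Record controller (R : realType) (nK nu ny : nat) := Controller {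
  ctA : 'M[R[i]]_nK;
  ctB : 'M[R[i]]_(nK, ny);
  ctC : 'M[R[i]]_(nu, nK);
  ctD : 'M[R[i]]_(nu, ny)
}.

(* The decision variables Y, lambda, t shared by the three programs. *)
Record gain (R : realType) (m : nat) := Gain {
  gnY : 'M[R[i]]_m;
  gnlam : R;
  gnt : R
}.

Definition gain_admissible (R : realType) (m : nat) (g : gain R m) : Prop :=
  [/\ gnY g \is hermsymmx,
      forall i j, `|gnY g i j| <= (gnt g)%:C,
      0 <= gnt g & 0 <= gnlam g].

Definition cost (R : realType) (m k : nat) (g : gain R m) : R :=
  gnlam g + k%:R * gnt g.

Definition lamIY (R : realType) (m : nat) (g : gain R m) : 'M[R[i]]_m :=
  ((gnlam g)%:C)%:M + gnY g.

Section Programs.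
Context (R : realType) (n m p nu ny : nat) (G : plant R n m p nu ny).

Local Notation A := (plA G).
Local Notation B1 := (plB1 G).
Local Notation B2 := (plB2 G).
Local Notation C1 := (plC1 G).
Local Notation C2 := (plC2 G).
Local Notation D11 := (plD11 G).
Local Notation D12 := (plD12 G).
Local Notation D21 := (plD21 G).

Section ClosedLoop.
Context (nK : nat) (K : controller R nK nu ny).

Local Notation AK := (ctA K).
Local Notation BK := (ctB K).
Local Notation CK := (ctC K).
Local Notation DK := (ctD K).

Definition Acl : 'M[R[i]]_(n + nK) :=
  block_mx (A + B2 *m DK *m C2) (B2 *m CK) (BK *m C2) AK.
Definition Bcl : 'M[R[i]]_(n + nK, m) :=
  col_mx (B1 + B2 *m DK *m D21) (BK *m D21).
Definition Ccl : 'M[R[i]]_(p, n + nK) :=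
  row_mx (C1 + D12 *m DK *m C2) (D12 *m CK).
Definition Dcl : 'M[R[i]]_(p, m) := D11 + D12 *m DK *m D21.

End ClosedLoop.

(* The stabilizing controller may have any order. *)
Definition stabilizable : Prop :=
  exists (nK : nat) (K : controller R nK nu ny), spectral_radius (Acl K) < 1.

Definition S_feasible (nK : nat) (K : controller R nK nu ny)
    (Pcl : 'M[R[i]]_(n + nK)) (g : gain R m) : Prop :=
  let Ac := Acl K in let Bc := Bcl K in
  let Cc := Ccl K in let Dc := Dcl K in
  [/\ posdefmx Pcl, gain_admissible g &
      negdefmx
        (block_mx (Ac^t* *m Pcl *m Ac - Pcl) (Ac^t* *m Pcl *m Bc)
                  (Bc^t* *m Pcl *m Ac)       (Bc^t* *m Pcl *m Bc - lamIY g)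
         + block_mx (Cc^t* *m Cc) (Cc^t* *m Dc)
                    (Dc^t* *m Cc) (Dc^t* *m Dc))].

Definition S_program (nK : nat) :
    set (controller R nK nu ny * 'M[R[i]]_(n + nK) * gain R m) :=
  [set x | S_feasible x.1.1 x.1.2 x.2].

Definition PQ_feasible (rc ro : nat)
    (Nc : 'M[R[i]]_(n + p, rc)) (No : 'M[R[i]]_(n + m, ro))
    (P Q : 'M[R[i]]_n) (g : gain R m) : Prop :=
  let Pic : 'M[R[i]]_(n + p + m, rc + m) := block_mx Nc 0 0 1%:M in
  let Pio : 'M[R[i]]_(n + m + p, ro + p) := block_mx No 0 0 1%:M in
  [/\ P \is hermsymmx /\ Q \is hermsymmx,
      gain_admissible g,
      posdefmx (block_mx P 1%:M 1%:M Q),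
      negdefmx (Pic^t* *m
        block_mx3
          (A *m Q *m A^t* - Q) (A *m Q *m C1^t*)         B1
          (C1 *m Q *m A^t*)    (C1 *m Q *m C1^t* - 1%:M) D11
          (B1^t*)              (D11^t*)                  (- lamIY g)
        *m Pic) &
      negdefmx (Pio^t* *m
        block_mx3
          (A^t* *m P *m A - P) (A^t* *m P *m B1)            (C1^t*)
          (B1^t* *m P *m A)    (B1^t* *m P *m B1 - lamIY g) (D11^t*)
          C1                   D11                          (- 1%:M)
        *m Pio)].

Definition PQ_program (rc ro : nat)
    (Nc : 'M[R[i]]_(n + p, rc)) (No : 'M[R[i]]_(n + m, ro)) :
    set ('M[R[i]]_n * 'M[R[i]]_n * gain R m) :=
  [set x | PQ_feasible Nc No x.1.1 x.1.2 x.2].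

Definition make_Pcl (nK : nat) (P : 'M[R[i]]_n) (P2 : 'M[R[i]]_(nK, n)) :
    'M[R[i]]_(n + nK) :=
  block_mx P (P2^t*) P2 1%:M.

Definition K_feasible (nK : nat) (Pcl : 'M[R[i]]_(n + nK))
    (K : controller R nK nu ny) (g : gain R m) : Prop :=
  let Ac := Acl K in let Bc := Bcl K in
  let Cc := Ccl K in let Dc := Dcl K in
  gain_admissible g /\
  posdefmx
    (block_mx (block_mx (invmx Pcl) 0 0 1%:M) (block_mx Ac Bc Cc Dc)
              (block_mx (Ac^t*) (Cc^t*) (Bc^t*) (Dc^t*)) (block_mx Pcl 0 0 (lamIY g))).

Definition K_program (nK : nat) (Pcl : 'M[R[i]]_(n + nK)) :
    set (controller R nK nu ny * gain R m) :=
  [set x | K_feasible Pcl x.1 x.2].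

End Programs.

Definition opt_value (R : realType) (T : Type) (F : set T) (f : T -> R) : R :=
  inf [set f x | x in F].

(* [eps = 0] gives the exact minimizers. The strict matrix inequalities make the
   feasible sets relatively open, so that the infimum of the cost is in general
   not attained and "solving" a program has to allow an arbitrary tolerance. *)
Definition minimizer_upto (R : realType) (T : Type) (eps : R)
    (F : set T) (f : T -> R) (x : T) : Prop :=
  F x /\ forall y, F y -> f x <= f y + eps.

(* Main.v *)
Require Import Defs.
From mathcomp Require Import all_boot all_order all_algebra.
From mathcomp Require Import complex.
From mathcomp Require Import boolp classical_sets reals.

Set Implicit Arguments.
Unset Strict Implicit.
Unset Printing Implicit Defensive.

Import Order.TTheory GRing.Theory Num.Theory.

Local Open Scope ring_scope.
Local Open Scope complex_scope.
Local Open Scope sesquilinear_scope.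
Local Open Scope classical_set_scope.

(* Write the closed-loop matrix as [X = M0 + U T W], affine in the block matrix
   [T] of controller coefficients, and put [H = diag(Pcl, I)],
   [L = diag(Pcl, lambda I + Y)].  The inequality of (S) says [X^* H X < L], and
   Schur complements turn it into [X L^-1 X^* < H^-1].  Restricting the first
   form to [Ker W] and the second to [Ker U^*] makes [T] disappear and leaves
   the two inequalities of (PQ), where [P] and [Q] are the upper-left blocks of
   [Pcl] and [Pcl^-1].  For these blocks [[P, I; I, Q]] is only semidefinite, so
   [P] has to be replaced by [P + e I]; this is harmless since the other
   inequalities are strict.  Conversely, a strict form of Parrott's theorem
   recovers [T] from the two restricted inequalities.  Hence (S), at any order
   at least [n], and (PQ) are feasible for the same [(Y, lambda, t)].  Finally,
   a stabilizing controller of any order satisfies a Stein inequality, which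
   after scaling and with [lambda] large makes (S) feasible at that order. *)

(** * Positive definite matrices *)

Section Adjoint.
Context {C : numClosedFieldType}.

Lemma adjmxM m n p (A : 'M[C]_(m, n)) (B : 'M[C]_(n, p)) :
  (A *m B)^t* = B^t* *m A^t*.
Proof. by rewrite trmx_mul map_mxM. Qed.

Lemma adjmxD m n (A B : 'M[C]_(m, n)) : (A + B)^t* = A^t* + B^t*.
Proof. by rewrite raddfD /= map_mxD. Qed.

Lemma adjmxN m n (A : 'M[C]_(m, n)) : (- A)^t* = - A^t*.
Proof. by rewrite raddfN /= map_mxN. Qed.

Lemma adjmxB m n (A B : 'M[C]_(m, n)) : (A - B)^t* = A^t* - B^t*.
Proof. by rewrite adjmxD adjmxN. Qed.

Lemma adjmx0 m n : (0 : 'M[C]_(m, n))^t* = 0.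
Proof. by rewrite trmx0 map_mx0. Qed.

Lemma adjmx_scalar n (c : C) : (c%:M : 'M[C]_n)^t* = (c^*)%R%:M.
Proof. by rewrite tr_scalar_mx map_scalar_mx. Qed.

Lemma adjmx1 n : (1%:M : 'M[C]_n)^t* = 1%:M.
Proof. by rewrite adjmx_scalar rmorph1. Qed.

Lemma adjmx_inv n (A : 'M[C]_n) : (invmx A)^t* = invmx (A^t*).
Proof. by rewrite trmx_inv map_invmx. Qed.

Lemma adjmx_block m1 m2 n1 n2 (A : 'M[C]_(m1, n1)) (B : 'M[C]_(m1, n2))
    (D : 'M[C]_(m2, n1)) (E : 'M[C]_(m2, n2)) :
  (block_mx A B D E)^t* = block_mx (A^t*) (D^t*) (B^t*) (E^t*).
Proof. by rewrite tr_block_mx map_block_mx. Qed.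

Lemma adjmx_row m n1 n2 (A : 'M[C]_(m, n1)) (B : 'M[C]_(m, n2)) :
  (row_mx A B)^t* = col_mx (A^t*) (B^t*).
Proof. by rewrite tr_row_mx map_col_mx. Qed.

Lemma adjmx_col m1 m2 n (A : 'M[C]_(m1, n)) (B : 'M[C]_(m2, n)) :
  (col_mx A B)^t* = row_mx (A^t*) (B^t*).
Proof. by rewrite tr_col_mx map_row_mx. Qed.

Definition adjE :=
  (adjmxM, adjmxB, adjmxD, adjmxN, adjmx0, adjmx1, adjmx_block, adjmx_row,
   adjmx_col, @trmxCK C).

Lemma adjmx_congrM m n p (X : 'M[C]_m) (S : 'M[C]_(m, n)) (T : 'M[C]_(n, p)) :
  (S *m T)^t* *m X *m (S *m T) = T^t* *m (S^t* *m X *m S) *m T.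
Proof. by rewrite adjmxM !mulmxA. Qed.

Lemma hermsymmxP n (M : 'M[C]_n) : reflect (M^t* = M) (M \is hermsymmx).
Proof.
apply: (iffP (is_hermitianmxP _ _ _)); rewrite expr0 scale1r.
  by move=> {2}->.
by move->.
Qed.

Lemma hermsymmxB n (M N : 'M[C]_n) :
  M \is hermsymmx -> N \is hermsymmx -> M - N \is hermsymmx.
Proof.
by move=> /hermsymmxP hM /hermsymmxP hN; apply/hermsymmxP; rewrite adjmxB hM hN.
Qed.

Lemma hermsymmx_congr m n (M : 'M[C]_m) (T : 'M[C]_(m, n)) :
  M \is hermsymmx -> T^t* *m M *m T \is hermsymmx.
Proof.
move=> /hermsymmxP hM; apply/hermsymmxP.
by rewrite !adjmxM trmxCK hM mulmxA.
Qed.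

End Adjoint.

(** * Congruence, block matrices and Schur complements for definite matrices *)

Section Definite.
Context {R : realType}.
Local Notation C := R[i].

Definition psdmx n (M : 'M[C]_n) : Prop :=
  M \is hermsymmx /\ forall v : 'cV[C]_n, 0 <= (v^t* *m M *m v) 0 0.

Lemma posdefmx_adj n (M : 'M[C]_n) : posdefmx M -> M^t* = M.
Proof. by case=> /hermsymmxP. Qed.

Lemma negdefmxN n (M : 'M[C]_n) : negdefmx M <-> posdefmx (- M).
Proof.
have qN (v : 'cV[C]_n) : (v^t* *m - M *m v) 0 0 = - (v^t* *m M *m v) 0 0.
  by rewrite mulmxN mulNmx mxE.
split=> -[/hermsymmxP hM pM]; (split; first apply/hermsymmxP).
- by rewrite adjmxN hM.
- by move=> v v0; rewrite qN oppr_gt0 pM.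
- by rewrite adjmxN in hM; apply: oppr_inj.
- by move=> v v0; rewrite -oppr_gt0 -qN pM.
Qed.

Lemma posdefmx_psd n (M : 'M[C]_n) : posdefmx M -> psdmx M.
Proof.
case=> hM pM; split=> // v; have [->|/pM/ltW//] := eqVneq v 0.
by rewrite mulmx0 mxE.
Qed.

Lemma psdmxD n (M N : 'M[C]_n) : psdmx M -> psdmx N -> psdmx (M + N).
Proof.
move=> [/hermsymmxP hM pM] [/hermsymmxP hN pN]; split.
  by apply/hermsymmxP; rewrite adjmxD hM hN.
by move=> v; rewrite mulmxDr mulmxDl mxE addr_ge0.
Qed.

Lemma posdefmxD_psd n (M N : 'M[C]_n) :
  posdefmx M -> psdmx N -> posdefmx (M + N).
Proof.
move=> [/hermsymmxP hM pM] [/hermsymmxP hN pN]; split.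
  by apply/hermsymmxP; rewrite adjmxD hM hN.
by move=> v v0; rewrite mulmxDr mulmxDl mxE ltr_wpDr ?pM.
Qed.

Lemma psdmx_congr m n (M : 'M[C]_m) (T : 'M[C]_(m, n)) :
  psdmx M -> psdmx (T^t* *m M *m T).
Proof.
move=> [/hermsymmxP hM pM]; split.
  by apply/hermsymmxP; rewrite !adjE hM mulmxA.
by move=> v; move: (pM (T *m v)); rewrite adjmxM !mulmxA.
Qed.

Lemma posdefmx_congr m n (M : 'M[C]_m) (T : 'M[C]_(m, n)) :
  (forall v : 'cV_n, T *m v = 0 -> v = 0) ->
  posdefmx M -> posdefmx (T^t* *m M *m T).
Proof.
move=> injT [/hermsymmxP hM pM]; split.
  by apply/hermsymmxP; rewrite !adjE hM mulmxA.
move=> v v0; have /pM : T *m v != 0 by apply: contra_neq v0; apply: injT.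
by rewrite adjmxM !mulmxA.
Qed.

Lemma posdefmx_congr_linv m n (M : 'M[C]_m) (T : 'M[C]_(m, n)) L :
  L *m T = 1%:M -> posdefmx M -> posdefmx (T^t* *m M *m T).
Proof.
move=> LT; apply: posdefmx_congr => v Tv.
by rewrite -[v]mul1mx -LT -mulmxA Tv mulmx0.
Qed.

Lemma posdefmx_congr_unit n (M T : 'M[C]_n) :
  T \in unitmx -> posdefmx (T^t* *m M *m T) <-> posdefmx M.
Proof.
move=> uT; split; last exact: posdefmx_congr_linv (mulVmx uT).
move=> pM.
have -> : M = (invmx T)^t* *m (T^t* *m M *m T) *m invmx T.
  rewrite !mulmxA -adjmxM mulmxV // adjmx1 mul1mx -mulmxA mulmxV //.
  by rewrite mulmx1.
exact: posdefmx_congr_linv (mulmxV uT) pM.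
Qed.

Lemma posdefmx_unit n (M : 'M[C]_n) : posdefmx M -> M \in unitmx.
Proof.
move=> [/hermsymmxP hM pM]; rewrite -row_free_unit -kermx_eq0.
apply: contraT => /rowV0Pn [u /sub_kermxP uM u0].
have /pM : u^t* != 0.
  by apply: contra_neq u0 => u0; rewrite -[u]trmxCK u0 adjmx0.
by rewrite trmxCK uM mul0mx mxE ltxx.
Qed.

Lemma posdefmx_inv n (M : 'M[C]_n) : posdefmx M -> posdefmx (invmx M).
Proof.
move=> pM; have uM := posdefmx_unit pM.
have -> : invmx M = (invmx M)^t* *m M *m invmx M.
  by rewrite adjmx_inv posdefmx_adj // mulVmx // mul1mx.
by apply/posdefmx_congr_unit; rewrite ?unitmx_inv.
Qed.

Lemma mulmx_col_ge0 n (v : 'cV[C]_n) : 0 <= (v^t* *m v) 0 0.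
Proof. by rewrite mxE sumr_ge0 // => i _; rewrite !mxE mulrC mul_conjC_ge0. Qed.

Lemma mulmx_col_eq0 n (v : 'cV[C]_n) : ((v^t* *m v) 0 0 == 0) = (v == 0).
Proof.
apply/idP/eqP => [|->]; last by rewrite mulmx0 mxE.
rewrite mxE psumr_eq0; last by move=> i _; rewrite !mxE mulrC mul_conjC_ge0.
move=> /allP v0; apply/colP => i; have := v0 i (mem_index_enum i).
by rewrite !mxE mulrC mul_conjC_eq0 => /eqP.
Qed.

Lemma posdefmx_scalar n (c : C) : 0 < c -> posdefmx (c%:M : 'M[C]_n).
Proof.
move=> c0; split.
  by apply/hermsymmxP; rewrite adjmx_scalar (CrealP (gtr0_real c0)).
move=> v v0; rewrite mul_mx_scalar -scalemxAl mxE mulr_gt0 //.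
by rewrite lt_def mulmx_col_eq0 v0 mulmx_col_ge0.
Qed.

Lemma posdefmx1 n : posdefmx (1%:M : 'M[C]_n).
Proof. by apply: posdefmx_scalar; rewrite ltr01. Qed.

Lemma psdmx_gram m n (T : 'M[C]_(m, n)) : psdmx (T^t* *m T).
Proof.
rewrite -[T^t*]mulmx1; apply: psdmx_congr; apply: posdefmx_psd.
exact: posdefmx1.
Qed.

Lemma psdmxZ n (c : C) (M : 'M[C]_n) : 0 <= c -> psdmx M -> psdmx (c *: M).
Proof.
move=> c0 [/hermsymmxP hM pM]; split.
  apply/hermsymmxP; rewrite linearZ /= map_mxZ hM.
  by congr (_ *: _); apply/CrealP/ger0_real.
by move=> v; rewrite -scalemxAr -scalemxAl mxE mulr_ge0.
Qed.

Lemma posdefmxZ n (c : C) (M : 'M[C]_n) :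
  0 < c -> posdefmx M -> posdefmx (c *: M).
Proof.
move=> c0 [/hermsymmxP hM pM]; split.
  apply/hermsymmxP; rewrite linearZ /= map_mxZ hM.
  by congr (_ *: _); apply/CrealP/gtr0_real.
by move=> v v0; rewrite -scalemxAr -scalemxAl mxE mulr_gt0 ?pM.
Qed.

Lemma posdefmx_diag_block m n (A : 'M[C]_m) (D : 'M[C]_n) :
  posdefmx (block_mx A 0 0 D) <-> posdefmx A /\ posdefmx D.
Proof.
split=> [pM|[[/hermsymmxP hA pA] [/hermsymmxP hD pD]]].
  split.
    have := @posdefmx_congr_linv _ _ _ (col_mx 1%:M 0) (row_mx 1%:M 0) _ pM.
    rewrite mul_row_col mulmx1 mulmx0 addr0 => /(_ erefl).
    rewrite !adjE mul_row_block !mulmx0 !mul0mx mul1mx !addr0.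
    by rewrite mul_row_col mulmx1 mul0mx addr0.
  have := @posdefmx_congr_linv _ _ _ (col_mx 0 1%:M) (row_mx 0 1%:M) _ pM.
  rewrite mul_row_col mulmx1 mulmx0 add0r => /(_ erefl).
  rewrite !adjE mul_row_block !mulmx0 !mul0mx mul1mx !add0r.
  by rewrite mul_row_col mulmx1 mul0mx add0r.
split; first by apply/hermsymmxP; rewrite !adjE hA hD.
move=> v; rewrite -[v]vsubmxK; set x := usubmx v; set y := dsubmx v.
move=> v0; rewrite !adjE mul_row_block !mulmx0 addr0 add0r mul_row_col mxE.
have [x0|x0] := eqVneq x 0; last first.
  have [_ qD] := posdefmx_psd (conj (introT (hermsymmxP _) hD) pD).
  by apply: ltr_pwDl; [exact: pA | exact: qD].
rewrite x0 mulmx0 mxE add0r pD //.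
by apply: contra_neq v0 => ->; rewrite x0 col_mx0.
Qed.

(** Block elimination: congruence by the unit upper triangular matrix with corner [invmx A *m B]
    turns the block matrix into the diagonal of [A] and its Schur complement. *)
Lemma posdefmx_schur1 m n (A : 'M[C]_m) (B : 'M[C]_(m, n)) (D : 'M[C]_n) :
  posdefmx (block_mx A B (B^t*) D) <->
  posdefmx A /\ posdefmx (D - B^t* *m invmx A *m B).
Proof.
have main : posdefmx A -> posdefmx (block_mx A B (B^t*) D) <->
    posdefmx (D - B^t* *m invmx A *m B).
  move=> pA; have uA := posdefmx_unit pA.
  pose T : 'M[C]_(m + n) := block_mx 1%:M (invmx A *m B) 0 1%:M.
  have uT : T \in unitmx by rewrite unitmxE det_ublock !det1 mulr1 unitr1.
  have -> : block_mx A B (B^t*) D =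
      T^t* *m block_mx A 0 0 (D - B^t* *m invmx A *m B) *m T.
    rewrite !adjE adjmx_inv posdefmx_adj //.
    rewrite !mulmx_block !(mulmx0, mul0mx, mulmx1, mul1mx, addr0, add0r).
    rewrite !mulmxA mulmxV // mul1mx -[_ *m invmx A *m A]mulmxA mulVmx //.
    by rewrite mulmx1 addrC subrK.
  rewrite posdefmx_congr_unit // posdefmx_diag_block.
  by split=> [[]|].
split=> [pM|[pA pS]]; last exact/main.
suff pA : posdefmx A by split=> //; apply/main.
have := @posdefmx_congr_linv _ _ _ (col_mx 1%:M 0) (row_mx 1%:M 0) _ pM.
rewrite mul_row_col mulmx1 mulmx0 addr0 => /(_ erefl).
rewrite !adjE mul_row_block !mul0mx !mul1mx !addr0.
by rewrite mul_row_col mulmx1 mulmx0 addr0.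
Qed.

Lemma posdefmx_block_swap m n (A : 'M[C]_m) (B : 'M[C]_(m, n)) (D : 'M[C]_n) :
  posdefmx (block_mx A B (B^t*) D) -> posdefmx (block_mx D (B^t*) B A).
Proof.
move=> /(@posdefmx_congr_linv _ _ _ (block_mx 0 1%:M 1%:M 0)
  (block_mx 0 1%:M 1%:M 0)).
rewrite !adjE !mulmx_block.
rewrite !(mulmx0, mul0mx, mulmx1, mul1mx, addr0, add0r).
by apply; rewrite -scalar_mx_block.
Qed.

Lemma posdefmx_schur2 m n (A : 'M[C]_m) (B : 'M[C]_(m, n)) (D : 'M[C]_n) :
  posdefmx (block_mx A B (B^t*) D) <->
  posdefmx D /\ posdefmx (A - B *m invmx D *m B^t*).
Proof.
have := posdefmx_schur1 D (B^t*) A; rewrite trmxCK => <-.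
split=> [|pM]; first exact: posdefmx_block_swap.
by have := @posdefmx_block_swap _ _ D (B^t*) A; rewrite trmxCK; apply.
Qed.

(** Both sides are Schur complements of one block matrix. This is the passage between the primal
    form [L - X^* H X] and the dual form [H^-1 - X L^-1 X^*]. *)
Lemma posdefmx_schur_swap m n (A : 'M[C]_m) (B : 'M[C]_(m, n)) (D : 'M[C]_n) :
  posdefmx A -> posdefmx (D - B^t* *m invmx A *m B) <->
  posdefmx D /\ posdefmx (A - B *m invmx D *m B^t*).
Proof.
move=> pA; rewrite -posdefmx_schur2 posdefmx_schur1.
by split=> [|[]].
Qed.

End Definite.

(** * Spectral bounds and the Stein inequality *)

Section Spectral.
Context {R : realType}.
Local Notation C := R[i].

Lemma hermsymmx_diagonalize n (M : 'M[C]_n) : M \is hermsymmx ->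
  exists (U : 'M[C]_n) (d : 'rV[C]_n),
    [/\ U^t* *m U = 1%:M, U *m U^t* = 1%:M, forall i, d 0 i \is Num.real &
        M = U^t* *m diag_mx d *m U].
Proof.
move=> hM; exists (spectralmx M), (spectral_diag M).
have uU := spectral_unitarymx M; have /unitarymxP UU := uU.
split=> //.
- by have := uU; rewrite -trmxC_unitary => /unitarymxP; rewrite trmxCK.
- by move=> i; apply/mxOverP/hermitian_spectral_diag_real.
- by rewrite -invmx_unitary //; apply/orthomx_spectralP/hermitian_normalmx.
Qed.

Lemma mulmx_diag_col n (d : 'rV[C]_n) (v : 'cV[C]_n) :
  (v^t* *m diag_mx d *m v) 0 0 = \sum_i d 0 i * `|v i 0| ^+ 2.
Proof.
rewrite mxE; apply: eq_bigr => i _; rewrite mul_mx_diag !mxE.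
by rewrite normCK mulrAC mulrC [v i 0 * _]mulrC.
Qed.

Lemma psdmx_diag n (d : 'rV[C]_n) :
  (forall i, 0 <= d 0 i) -> psdmx (diag_mx d).
Proof.
move=> d0; split.
  apply/hermsymmxP/matrixP => i j; rewrite !mxE eq_sym.
  have [->|_] := eqVneq i j; last by rewrite !mulr0n rmorph0.
  by rewrite !mulr1n; apply/CrealP/ger0_real.
by move=> v; rewrite mulmx_diag_col sumr_ge0 // => i _;
  rewrite mulr_ge0 ?exprn_ge0.
Qed.

Lemma scalar_diag_mxB n (c : C) (d : 'rV[C]_n) (U : 'M[C]_n) :
  U^t* *m U = 1%:M ->
  c%:M - U^t* *m diag_mx d *m U = U^t* *m diag_mx (const_mx c - d) *m U.
Proof.
move=> UU; rewrite raddfB /= diag_const_mx mulmxBr mulmxBl.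
by rewrite mul_mx_scalar -scalemxAl UU scalemx1.
Qed.

Lemma hermsymmx_ubound n (M : 'M[C]_n) : M \is hermsymmx ->
  exists2 c : C, 0 <= c & psdmx (c%:M - M).
Proof.
move=> /hermsymmx_diagonalize [U [d [UU _ dR ->]]].
(* The sum of the moduli of the eigenvalues dominates each of them and makes sense in dimension 0,
   where there is no largest one. *)
exists (\sum_i `|d 0 i|); first exact: sumr_ge0.
rewrite scalar_diag_mxB //; apply/psdmx_congr/psdmx_diag => i.
rewrite !mxE subr_ge0 (bigD1 i) //= (le_trans (real_ler_norm (dR i))) //.
by rewrite lerDl sumr_ge0.
Qed.

Lemma posdefmx_diagonalize n (M : 'M[C]_n) : posdefmx M ->
  exists (U : 'M[C]_n) (d : 'rV[C]_n),
    [/\ U^t* *m U = 1%:M, forall i, 0 < d 0 i & M = U^t* *m diag_mx d *m U].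
Proof.
move=> pM; have [hM _] := pM.
have [U [d [UU UU' _ dM]]] := hermsymmx_diagonalize hM.
exists U, d; split=> // i.
have : posdefmx (diag_mx d).
  have <- : U *m M *m U^t* = diag_mx d.
    by rewrite dM !mulmxA UU' mul1mx -mulmxA UU' mulmx1.
  by rewrite -{1}[U]trmxCK; apply: (posdefmx_congr_linv (L := U)).
case=> _ /(_ (delta_mx i 0)) => /(_ _).
have -> : delta_mx i 0 != 0 :> 'cV[C]_n.
  by apply/eqP => /colP/(_ i)/eqP; rewrite !mxE !eqxx oner_eq0.
move=> /(_ isT); rewrite mulmx_diag_col (bigD1 i) //= big1 => [|j /negPf ji].
  by rewrite !mxE !eqxx normr1 expr1n mulr1 addr0.
by rewrite !mxE ji /= normr0 expr0n mulr0.
Qed.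

Lemma posdefmx_lbound n (M : 'M[C]_n) : posdefmx M ->
  exists2 c : C, 0 < c & psdmx (M - c%:M).
Proof.
move=> /posdefmx_diagonalize [U [d [UU d0 ->]]].
have s0 : 0 <= \sum_i (d 0 i)^-1.
  by apply: sumr_ge0 => i _; rewrite invr_ge0 ltW.
(* The inverse of this constant exceeds every [(d 0 i)^-1], so the constant lies below every
   eigenvalue; the summand 1 keeps it positive in dimension 0. *)
exists (1 + \sum_i (d 0 i)^-1)^-1; first by rewrite invr_gt0 ltr_wpDr.
rewrite -opprB scalar_diag_mxB // -mulNmx -mulmxN -raddfN /= opprB.
apply/psdmx_congr/psdmx_diag => i.
rewrite !mxE subr_ge0 -[leRHS]invrK lef_pV2 ?posrE ?invr_gt0 ?ltr_wpDr //.
rewrite (bigD1 i) //= addrCA lerDl addr_ge0 //.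
by apply: sumr_ge0 => j _; rewrite invr_ge0 ltW.
Qed.

Lemma posdefmx_open n (M N : 'M[C]_n) : posdefmx M -> N \is hermsymmx ->
  exists2 e : C, 0 < e & forall e', 0 < e' -> e' <= e -> posdefmx (M + e' *: N).
Proof.
move=> pM hN; have [c c0 pc] := posdefmx_lbound pM.
have : - N \is hermsymmx.
  by apply/hermsymmxP; rewrite adjmxN (hermsymmxP _ hN).
move=> /hermsymmx_ubound [d d0]; rewrite opprK => pd.
have d1 : 0 < d + 1 by rewrite ltr_wpDl.
(* With [M] above [c] and [N] above [-d], the sum stays positive as soon as [e * d < c]; the [+ 1]
   makes this strict and the denominator nonzero. *)
exists (c / (d + 1)) => [|e e0 ec]; first by rewrite divr_gt0.
have -> : M + e *: N = (c - e * d)%:M + ((M - c%:M) + e *: (d%:M + N)).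
  rewrite scalerDr scale_scalar_mx raddfB /= addrACA [M - _]addrC !addrA.
  by rewrite subrK [_ - _ + M]addrC -!addrA addNKr.
have pe : psdmx (e *: (d%:M + N)) by exact: psdmxZ (ltW e0) pd.
apply: (posdefmxD_psd _ (psdmxD pc pe)).
apply: posdefmx_scalar; rewrite subr_gt0.
apply: (@lt_le_trans _ _ (e * (d + 1))); first by rewrite ltr_pM2l // ltrDl.
by rewrite -ler_pdivlMr.
Qed.

(** The square root read off from the diagonalization is padded with zero rows. Applied to
    [P - invmx Q], it produces [P2] at every controller order at least [n]. *)
Lemma posdefmx_factor n p (M : 'M[C]_n) : (n <= p)%N -> posdefmx M ->
  exists T : 'M[C]_(p, n), M = T^t* *m T.
Proof.
move=> np /posdefmx_diagonalize [U [d [UU d0 ->]]].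
rewrite -(subnKC np).
exists (col_mx (diag_mx (map_mx sqrtC d) *m U) 0).
rewrite adjmx_col mul_row_col [X in _ + X]mulmx0 addr0 adjmxM !mulmxA.
congr (_ *m _).
rewrite -mulmxA; congr (_ *m _).
apply/matrixP => i j; rewrite mul_mx_diag !mxE eq_sym.
have [->|_] := eqVneq i j; last by rewrite !mulr0n rmorph0 mul0r.
rewrite !mulr1n (CrealP _) -?expr2 ?sqrtCK //.
by apply: ger0_real; rewrite sqrtC_ge0 ltW.
Qed.

(** Induction on the dimension, splitting the lower triangular matrix as [[a, 0; b, T']]. A block
    diagonal solution works once the weight [al] of the first coordinate is large enough for
    [|a| < 1] to outweigh the coupling through [b]. *)
Lemma trig_stein n (T : 'M[C]_n) : is_trig_mx T ->
  (forall i, `|T i i| < 1) ->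
  exists2 P : 'M[C]_n, posdefmx P & posdefmx (P - T^t* *m P *m T).
Proof.
elim: n T => [|n IHn] T.
  have p0 (M : 'M[C]_0) : posdefmx M.
    split=> [|v]; rewrite ?flatmx0 ?eqxx //.
    by apply/hermsymmxP; rewrite !flatmx0.
  by move=> _ _; exists 0.
rewrite -[n.+1]/(1 + n)%N in T *.
move=> tT dT; have : is_trig_mx T by [].
rewrite -[T]submxK; set a := ulsubmx T; set b := dlsubmx T; set T' := drsubmx T.
have -> : ursubmx T = 0.
  by apply/matrixP => i j; rewrite !mxE (is_trig_mxP tT) //= ord1.
rewrite is_trig_block_mx // => /andP[_ /andP[_ tT']].
have [i|P pP pS] := IHn T' tT'.
  by rewrite !mxE; apply: dT.
pose B := - (b^t* *m P *m T').
pose s := (b^t* *m P *m b + B *m invmx (P - T'^t* *m P *m T') *m B^t*) 0 0.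
have a1 : 0 < 1 - `|a 0 0| ^+ 2.
  by rewrite subr_gt0 expr_lt1 // !mxE; apply: dT.
have s0 : 0 <= s.
  have [_ p1] := psdmx_congr b (posdefmx_psd pP).
  have [_ p2] := psdmx_congr (B^t*) (posdefmx_psd (posdefmx_inv pS)).
  have := addr_ge0 (p1 1%:M) (p2 1%:M).
  rewrite !adjmx1 !mul1mx !mulmx1 trmxCK => s0.
  by rewrite /s [leRHS]mxE.
have aE : (a^t* *m a) 0 0 = `|a 0 0| ^+ 2.
  by rewrite mxE big_ord1 [a^t* _ _]mxE [a^T _ _]mxE normCK mulrC.
(* This choice makes the Schur complement in the first coordinate exactly 1: [s] collects everything
   that is subtracted from [al * (1 - |a|^2)]. *)
have [al al0 alE] : exists2 al : C, 0 < al & al * (1 - `|a 0 0| ^+ 2) = 1 + s.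
  exists ((1 + s) / (1 - `|a 0 0| ^+ 2)); last by rewrite divfK ?gt_eqF.
  by rewrite divr_gt0 // ltr_wpDr.
exists (block_mx al%:M 0 0 P).
  by apply/posdefmx_diag_block; split=> //; apply: posdefmx_scalar.
have -> : block_mx al%:M 0 0 P
    - (block_mx a 0 b T')^t* *m block_mx al%:M 0 0 P *m block_mx a 0 b T' =
    block_mx (al%:M - (a^t* *m al%:M *m a + b^t* *m P *m b)) B (B^t*)
      (P - T'^t* *m P *m T').
  rewrite !adjE !mulmx_block !(mulmx0, mul0mx, addr0, add0r).
  rewrite opp_block_mx add_block_mx; congr block_mx; rewrite add0r.
    exact: erefl.
  by rewrite (posdefmx_adj pP) mulmxA.
apply/posdefmx_schur2; split=> //.
suff -> : al%:M - (a^t* *m al%:M *m a + b^t* *m P *m b) -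
    B *m invmx (P - T'^t* *m P *m T') *m B^t* = 1%:M by exact: posdefmx1.
rewrite -!addrA -opprD -addrA; apply/matrixP => i j; rewrite !ord1.
rewrite mxE [X in _ + X]mxE [X in _ - X]mxE -/s.
rewrite mul_mx_scalar -scalemxAl [X in _ - (X + _)]mxE aE.
rewrite [al%:M _ _]mxE [1%:M _ _]mxE mulr1n.
by rewrite opprD addrA -{1}[al]mulr1 -mulrBr alE addrK.
Qed.

(** Schur triangularization reduces to [trig_stein]: the diagonal of the triangular form consists of
    eigenvalues of [A], and unitary congruence carries the solution back. *)
Lemma stein n (A : 'M[C]_n) : spectral_radius A < 1 ->
  exists2 P : 'M[C]_n, posdefmx P & posdefmx (P - A^t* *m P *m A).
Proof.
case: n A => [|n] A rA.
  by apply: trig_stein => [|[]//]; apply/is_trig_mxP => -[].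
have [U uU /=] := Schur A isT; rewrite /similar_to /=.
set T := conjmx U A => tT.
have Uu := unitarymx_unit uU.
have AT : A = conjmx (invmx U) T by rewrite conjmxK.
have eT i : eigenvalue T (T i i).
  rewrite eigenvalue_root_char char_poly_trig //.
  rewrite -(big_map (fun i => T i i) xpredT (fun x => 'X - x%:P)).
  by rewrite root_prod_XsubC; apply/mapP; exists i; rewrite ?mem_index_enum.
have TA a : eigenvalue T a -> eigenvalue A a.
  by apply: eigenvalue_conjmx; rewrite ?stablemx_unit ?row_free_unit.
(* The supremum in [spectral_radius] dominates its elements only for a bounded set; each eigenvalue
   is a diagonal entry of [T], which gives the bound. *)
have bA : has_ubound
    [set ComplexField.Normc.normc a | a in [set a | eigenvalue A a]].
  exists (\sum_i ComplexField.Normc.normc (T i i)) => _ [a /= ea <-].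
  have : eigenvalue T a.
    move: ea; rewrite AT; apply: eigenvalue_conjmx;
      by rewrite ?stablemx_unit ?row_free_unit ?unitmx_inv.
  rewrite eigenvalue_root_char char_poly_trig //.
  rewrite -(big_map (fun i => T i i) xpredT (fun x => 'X - x%:P)).
  rewrite root_prod_XsubC.
  move=> /mapP [i _ ->]; rewrite (bigD1 i) //= lerDl sumr_ge0 // => j _.
  by case: (T j j) => x y; exact: sqrtr_ge0.
have [P pP pS] : exists2 P, posdefmx P & posdefmx (P - T^t* *m P *m T).
  apply: trig_stein => // i; rewrite (_ : 1 = 1%:C) // ltcR.
  apply: le_lt_trans rA; apply: (ub_le_sup bA).
  by exists (T i i) => //; apply: TA.
exists (U^t* *m P *m U).
  by apply/posdefmx_congr_unit.
move: pS; rewrite /T (conjymx _ uU) -(posdefmx_congr_unit _ Uu).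
have UU : U^t* *m U = 1%:M by rewrite -invmx_unitary // mulVmx.
rewrite mulmxBr mulmxBl !adjE !mulmxA UU mul1mx.
by rewrite -[_ *m U^t* *m U]mulmxA UU mulmx1.
Qed.

End Spectral.

(** * Strict Parrott theorem *)

Section Parrott.
Context {R : realType}.
Local Notation C := R[i].

Lemma mulmx_col_inj0 m n (A : 'M[C]_(m, n)) :
  (forall v : 'cV[C]_n, A *m v = 0) -> A = 0.
Proof.
move=> A0; apply/matrixP => i j; have /colP/(_ i) := A0 (delta_mx j 0).
by rewrite -colE !mxE.
Qed.

Lemma orthonormal_kernel_mul0 q d r (M : 'M[C]_(q, d)) (N : 'M[C]_(d, r)) :
  orthonormal_kernel M N -> M *m N = 0.
Proof.
move=> [_ kN]; apply: mulmx_col_inj0 => v; rewrite -mulmxA.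
by apply/kN; exists v.
Qed.

Lemma orthonormal_kernelK q d r p (M : 'M[C]_(q, d)) (N : 'M[C]_(d, r))
    (X : 'M[C]_(d, p)) :
  orthonormal_kernel M N -> M *m X = 0 -> X = N *m (N^t* *m X).
Proof.
move=> [NN kN] MX; apply/eqP; rewrite -subr_eq0; apply/eqP.
apply: mulmx_col_inj0 => v; rewrite mulmxBl -!mulmxA.
have [w ->] : exists w, X *m v = N *m w by apply/kN; rewrite mulmxA MX mul0mx.
by rewrite [N^t* *m _]mulmxA NN mul1mx subrr.
Qed.

(** Vanishing on [Ker W] puts the rows of [Z] in the row space of [W]; being annihilated by [F^*]
    puts its columns in the range of [U]. Pseudo-inverses then give the middle factor. *)
Lemma orthonormal_kernel_factor q s d e r t
    (U : 'M[C]_(d, q)) (W : 'M[C]_(s, e)) (F : 'M[C]_(d, r)) (E : 'M[C]_(e, t))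
    (Z : 'M[C]_(d, e)) :
  orthonormal_kernel (U^t*) F -> orthonormal_kernel W E ->
  F^t* *m Z = 0 -> Z *m E = 0 -> exists T, Z = U *m T *m W.
Proof.
move=> kF kE FZ ZE.
have /mulmxKpV ZW : (Z <= W)%MS.
  rewrite submxE (orthonormal_kernelK kE (mulmx_coker W)).
  by rewrite mulmxA ZE mul0mx.
have /mulmxKpV ZU : (Z^t* <= U^t*)%MS.
  rewrite submxE (orthonormal_kernelK kF (mulmx_coker (U^t*))).
  by rewrite mulmxA -{1}[F]trmxCK -adjmxM FZ adjmx0 mul0mx.
have [Y ZY] : exists Y, Z = U *m Y.
  exists ((Z^t* *m pinvmx (U^t*))^t*).
  by rewrite -[LHS]trmxCK -[in LHS]ZU [LHS]adjmxM trmxCK.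
by exists (Y *m pinvmx W); rewrite mulmxA -ZY ZW.
Qed.

(* With [s = K^-1 E^* L v] the form splits as
   [(v - E s)^* L (v - E s) + s^* (K - V) s]. *)
Lemma posdefmx_compress e r (L : 'M[C]_e) (E : 'M[C]_(e, r)) (K V : 'M[C]_r) :
  posdefmx L -> E^t* *m L *m E = K -> posdefmx K -> posdefmx (K - V) ->
  posdefmx (L - (invmx K *m (E^t* *m L))^t* *m V *m (invmx K *m (E^t* *m L))).
Proof.
move=> pL EK pK pKV; have hL := posdefmx_adj pL; have hK := posdefmx_adj pK.
have uK := posdefmx_unit pK.
have [B BE] : exists B, B = E^t* *m L by exists (E^t* *m L).
rewrite -BE; have BEh : B^t* = L *m E by rewrite BE adjmxM trmxCK hL.
have EB : B *m E = K by rewrite BE.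
have [S SE] : exists S, S = invmx K *m B by exists (invmx K *m B).
rewrite -SE; have KS : K *m S = B by rewrite SE mulmxA mulmxV // mul1mx.
have BS : B = K *m S by [].
have id : L - S^t* *m V *m S =
    (1%:M - E *m S)^t* *m L *m (1%:M - E *m S) + S^t* *m (K - V) *m S.
  have a1 : (E *m S)^t* *m L = S^t* *m K *m S.
    by rewrite adjmxM -mulmxA -BE BS mulmxA.
  have a2 : L *m (E *m S) = S^t* *m K *m S.
    by rewrite mulmxA -BEh BS adjmxM hK.
  have a3 : S^t* *m K *m S *m (E *m S) = S^t* *m K *m S.
    by rewrite -{1}a1 adjmxM -EK !mulmxA.
  have -> : (1%:M - E *m S)^t* *m L *m (1%:M - E *m S) = L - S^t* *m K *m S.
    rewrite adjmxB adjmx1 mulmxBl mul1mx a1 mulmxBr mulmx1 mulmxBl a2 a3.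
    by rewrite subrr subr0.
  by rewrite mulmxBr mulmxBl addrA subrK.
rewrite id.
have [hP pP] := psdmx_congr (1%:M - E *m S) (posdefmx_psd pL).
have [hQ pQ] := psdmx_congr S (posdefmx_psd pKV).
split; first by have [] := psdmxD (conj hP pP) (conj hQ pQ).
move=> v v0; rewrite mulmxDr mulmxDl mxE.
(* If [s = S v] vanishes then [v - E s = v], so the first square is strictly positive; otherwise the
   second one is. *)
have [s0|s0] := eqVneq (S *m v) 0.
  apply: ltr_pwDl; last exact: pQ.
  have -> : v^t* *m ((1%:M - E *m S)^t* *m L *m (1%:M - E *m S)) *m v =
      ((1%:M - E *m S) *m v)^t* *m L *m ((1%:M - E *m S) *m v).
    by rewrite [in RHS]adjmxM !mulmxA.
  have -> : (1%:M - E *m S) *m v = v.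
    by rewrite mulmxBl mul1mx -mulmxA s0 mulmx0 subr0.
  by case: pL => _; apply.
apply: ltr_wpDl; first exact: pP.
have -> : v^t* *m (S^t* *m (K - V) *m S) *m v =
    (S *m v)^t* *m (K - V) *m (S *m v) by rewrite adjmxM !mulmxA.
by case: pKV => _; apply.
Qed.

(* Removing from [M0] the part [S] that is [H]-orthogonal to the range of [U]
   leaves a map into that range, prescribed on [Ker W] only; it is extended
   by zero on the complement of [Ker W] orthogonal for [L' = L - S^* H S]. *)
Lemma strict_parrott f e u w rf re (H : 'M[C]_f) (L : 'M[C]_e)
    (M0 : 'M[C]_(f, e)) (U : 'M[C]_(f, u)) (W : 'M[C]_(w, e))
    (F : 'M[C]_(f, rf)) (E : 'M[C]_(e, re)) :
  posdefmx H -> posdefmx L ->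
  orthonormal_kernel (U^t*) F -> orthonormal_kernel W E ->
  posdefmx (F^t* *m (invmx H - M0 *m invmx L *m M0^t*) *m F) ->
  posdefmx (E^t* *m (L - M0^t* *m H *m M0) *m E) ->
  exists T : 'M[C]_(u, w),
    posdefmx (L - (M0 + U *m T *m W)^t* *m H *m (M0 + U *m T *m W)).
Proof.
move=> pH pL kF kE pFM pEM; have uH := posdefmx_unit pH.
have hH := posdefmx_adj pH; have FF := kF.1; have EE := kE.1.
have [G GE] : exists G, G = F^t* *m invmx H *m F by eexists.
have pG : posdefmx G.
  by rewrite GE; apply: (posdefmx_congr_linv FF); apply: posdefmx_inv.
have uG := posdefmx_unit pG.
have [B BE] : exists B, B = F^t* *m M0 by eexists.
have BEh : B^t* = M0^t* *m F by rewrite BE adjmxM trmxCK.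
have [L' L'E] : exists L', L' = L - B^t* *m invmx G *m B by eexists.
(* [B = F^* M0] is the part of the closed loop that no [T] changes, because [F^* U = 0]. The dual
   hypothesis bounds it, and the Schur swap turns this bound into positivity of [L']. *)
have pL' : posdefmx L'.
  have pGB : posdefmx (G - (B^t*)^t* *m invmx L *m B^t*).
    have -> : G - (B^t*)^t* *m invmx L *m B^t* =
        F^t* *m (invmx H - M0 *m invmx L *m M0^t*) *m F.
      by rewrite trmxCK mulmxBr mulmxBl -GE BEh BE !mulmxA.
    exact: pFM.
  by have [_] := (posdefmx_schur_swap (B^t*) G pL).1 pGB; rewrite trmxCK -L'E.
have [S SE] : exists S, S = invmx H *m F *m invmx G *m B by eexists.
have FS : F^t* *m S = B by rewrite SE !mulmxA -GE (mulmxV uG) mul1mx.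
have HS : H *m S = F *m invmx G *m B.
  by rewrite SE !mulmxA (mulmxV uH) mul1mx.
have SH : S^t* *m H = B^t* *m invmx G *m F^t*.
  by rewrite -{1}hH -adjmxM HS !adjmxM adjmx_inv (posdefmx_adj pG) mulmxA.
(* Pythagoras: [H S] factors through [F], so cross terms with anything annihilated by [F^*] vanish,
   and [S^* H S = B^* G^-1 B]. *)
have cross (T : 'M_(f, e)) : F^t* *m T = 0 ->
    L - (S + T)^t* *m H *m (S + T) = L' - T^t* *m H *m T.
  move=> FT; have TF : T^t* *m F = 0.
    by rewrite -[F]trmxCK -adjmxM FT adjmx0.
  rewrite adjmxD mulmxDl SH mulmxDl !mulmxDr -!mulmxA FS FT !mulmx0 addr0.
  rewrite HS !mulmxA TF !mul0mx add0r opprD addrA.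
  by rewrite -[_ *m invmx G *m B]mulmxA L'E mulmxA.
have [T0 T0E] : exists T0, T0 = M0 - S by eexists.
have FT0 : F^t* *m T0 = 0 by rewrite T0E mulmxBr FS BE subrr.
have MT0 : M0 = S + T0 by rewrite T0E addrC subrK.
have [K KE] : exists K, E^t* *m L' *m E = K by eexists.
have pK : posdefmx K.
  by rewrite -KE; apply: (posdefmx_congr_linv EE).
have uK := posdefmx_unit pK.
have pKV : posdefmx (K - (T0 *m E)^t* *m H *m (T0 *m E)).
  move: pEM; rewrite {1 2}MT0 (cross _ FT0) mulmxBr mulmxBl KE.
  by rewrite adjmxM !mulmxA.
have := posdefmx_compress pL' KE pK pKV.
have [Q QE] : exists Q, Q = invmx K *m (E^t* *m L') by eexists.
rewrite -QE => pX.
have QE1 : Q *m E = 1%:M by rewrite QE -mulmxA KE (mulVmx uK).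
(* [Q] is a left inverse of [E] vanishing on the [L']-orthogonal complement of its range. Thus [T]
   agrees with [T0] on [Ker W], still satisfies [F^* T = 0], and differs from [T0] by some
   [U Th W]. *)
have [T TE] : exists T, T = T0 *m E *m Q by eexists.
have FT : F^t* *m T = 0 by rewrite TE !mulmxA FT0 !mul0mx.
have [||Th ThE] :=
  @orthonormal_kernel_factor _ _ _ _ _ _ U W F E (T - T0) kF kE.
- by rewrite mulmxBr FT FT0 subrr.
- by rewrite mulmxBl TE -[_ *m Q *m E]mulmxA QE1 mulmx1 subrr.
exists Th; rewrite -ThE [T - T0]addrC MT0 addrA addrK (cross _ FT).
by rewrite TE [in X in X *m H]adjmxM !mulmxA; rewrite !mulmxA in pX.
Qed.

End Parrott.

(** * Closed-loop inequalities *)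

Section Embedding.
Context {R : realType}.
Local Notation C := R[i].

(** The isometry that inserts a zero controller state between the plant state and the external
    signal. *)
Definition embed n nK d : 'M[C]_(n + nK + d, n + d) :=
  block_mx (col_mx 1%:M 0) 0 0 1%:M.

Lemma adjmx_embed n nK d :
  (embed n nK d)^t* = block_mx (row_mx 1%:M 0) 0 0 1%:M.
Proof. by rewrite /embed adjmx_block adjmx_col !adjmx1 !adjmx0. Qed.

Lemma embed_block n nK d1 d2 (M11 : 'M[C]_(n + nK)) (M12 : 'M[C]_(n + nK, d2))
    (M21 : 'M[C]_(d1, n + nK)) (M22 : 'M[C]_(d1, d2)) :
  (embed n nK d1)^t* *m block_mx M11 M12 M21 M22 *m embed n nK d2 =
  block_mx (ulsubmx M11) (usubmx M12) (lsubmx M21) M22.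
Proof.
rewrite adjmx_embed /embed -[M11]submxK -[M12]vsubmxK -[M21]hsubmxK.
rewrite !mulmx_block !mul_row_block !mul_row_col.
rewrite !(mulmx0, mul0mx, mulmx1, mul1mx, addr0, add0r).
rewrite !mul_row_col !(mulmx0, mulmx1, addr0).
by rewrite block_mxKul col_mxKu row_mxKl.
Qed.

Lemma embed_diag n nK d (M : 'M[C]_(n + nK)) (D : 'M[C]_d) :
  (embed n nK d)^t* *m block_mx M 0 0 D *m embed n nK d =
  block_mx (ulsubmx M) 0 0 D.
Proof.
by rewrite embed_block; congr block_mx; apply/matrixP=> i j; rewrite !mxE.
Qed.

Lemma embedK n nK d : (embed n nK d)^t* *m embed n nK d = 1%:M.
Proof.
rewrite adjmx_embed mulmx_block mul_row_col.
rewrite !(mulmx0, mul0mx, mulmx1, mul1mx, addr0, add0r).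
by rewrite -scalar_mx_block.
Qed.

(** It sends [(x, zeta, w)] to [(zeta, M x + D w)]. With [C2] and [D21] this is the factor [W] of
    the closed loop; with [B2^*] and [D12^*] it is [U^*]. *)
Definition lift_kernel n nK q d (M : 'M[C]_(q, n)) (D : 'M[C]_(q, d)) :
    'M[C]_(nK + q, n + nK + d) :=
  block_mx (row_mx 0 1%:M) 0 (row_mx M 0) D.

(** A vector in the lifted kernel has zero controller state, so only the kernel of [row_mx M D]
    remains. This is why the order [nK] does not appear in (PQ). *)
Lemma orthonormal_kernel_embed n nK q d r (M : 'M[C]_(q, n)) (D : 'M[C]_(q, d))
    (N : 'M[C]_(n + d, r)) :
  orthonormal_kernel (row_mx M D) N ->
  orthonormal_kernel (lift_kernel nK M D) (embed n nK d *m N).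
Proof.
move=> kN; have [NN rN] := kN; split.
  by rewrite adjmxM mulmxA -[N^t* *m _ *m _]mulmxA embedK mulmx1.
move=> v; split=> [[w ->]|].
  rewrite !mulmxA; have -> : lift_kernel nK M D *m embed n nK d =
      col_mx 0 (row_mx M D).
    rewrite mulmx_block !mul_row_col.
    rewrite !(mulmx0, mul0mx, mulmx1, mul1mx, addr0, add0r).
    by rewrite block_mxEv row_mx0.
  by rewrite mul_col_mx (orthonormal_kernel_mul0 kN) !mul0mx col_mx0 mul0mx.
rewrite -[v]vsubmxK -[usubmx v]vsubmxK.
move: (usubmx (usubmx v)) (dsubmx (usubmx v)) (dsubmx v) => x z y.
rewrite mul_block_col !mul_row_col !mul0mx mul1mx add0r !addr0.
rewrite -[0 in RHS]col_mx0 => /eq_col_mx [-> Mxy].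
have /rN [w xyw] : row_mx M D *m col_mx x y = 0 by rewrite mul_row_col.
exists w; rewrite -mulmxA -xyw mul_block_col mul_col_mx.
by rewrite !(mul0mx, mul1mx, addr0, add0r).
Qed.

Lemma invmx_diag_block m n (A : 'M[C]_m) (D : 'M[C]_n) :
  A \in unitmx -> D \in unitmx ->
  invmx (block_mx A 0 0 D) = block_mx (invmx A) 0 0 (invmx D).
Proof.
move=> uA uD; apply: (@row_full_inj _ _ _ _ (block_mx A 0 0 D)).
  by rewrite row_full_unit unitmxE det_ublock unitrM -!unitmxE uA.
rewrite mulmxV; last by rewrite unitmxE det_ublock unitrM -!unitmxE uA.
rewrite mulmx_block !(mulmx0, mul0mx, addr0, add0r).
by rewrite (mulmxV uA) (mulmxV uD) -scalar_mx_block.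
Qed.

(** The outer factor is the identity on the last block, so the Schur complement with respect to that
    block commutes with the restriction by [N]. *)
Lemma kernel_lmiP d m r (N : 'M[C]_(d, r)) (Y : 'M[C]_d) (F : 'M[C]_(d, m))
    (Z : 'M[C]_m) :
  negdefmx ((block_mx N 0 0 1%:M : 'M_(d + m, r + m))^t*
    *m block_mx (- Y) F (F^t*) (- Z) *m block_mx N 0 0 1%:M) <->
  posdefmx Z /\ posdefmx (N^t* *m (Y - F *m invmx Z *m F^t*) *m N).
Proof.
rewrite negdefmxN adjmx_block !adjmx0 adjmx1 !mulmx_block.
rewrite !(mulmx0, mul0mx, mulmx1, mul1mx, addr0, add0r) opp_block_mx opprK.
rewrite mulmxN mulNmx opprK.
have -> : - (F^t* *m N) = (- (N^t* *m F))^t* by rewrite adjmxN adjmxM trmxCK.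
rewrite posdefmx_schur2.
suff -> : N^t* *m Y *m N - - (N^t* *m F) *m invmx Z *m (- (N^t* *m F))^t* =
  N^t* *m (Y - F *m invmx Z *m F^t*) *m N by [].
rewrite adjmxN adjmxM trmxCK mulNmx mulmxN mulNmx opprK.
by rewrite mulmxBr mulmxBl !mulmxA.
Qed.

(** With [P] and [Q] the upper-left blocks of [Pcl] and its inverse, [P - Q^-1] is a congruence of
    [Pcl], hence semidefinite; the shift by [e] makes it strict. *)
Lemma posdefmx_ulsubmx_inv n nK (Pcl : 'M[C]_(n + nK)) (e : C) :
  posdefmx Pcl -> 0 < e ->
  posdefmx (block_mx (ulsubmx Pcl + e%:M) 1%:M 1%:M (ulsubmx (invmx Pcl))).
Proof.
move=> pP e0; have uP := posdefmx_unit pP; have hP := posdefmx_adj pP.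
have pI := posdefmx_inv pP.
pose J : 'M[C]_(n + nK, n) := col_mx 1%:M 0.
have JE : J^t* = row_mx 1%:M 0 by rewrite /J adjmx_col adjmx1 adjmx0.
have ul (M : 'M[C]_(n + nK)) : ulsubmx M = J^t* *m M *m J.
  rewrite JE -[M in RHS]submxK mul_row_block !mul0mx !mul1mx !addr0.
  by rewrite mul_row_col mulmx1 mulmx0 addr0.
have JJ : J^t* *m J = 1%:M by rewrite JE mul_row_col mulmx1 mulmx0 addr0.
have pQ : posdefmx (ulsubmx (invmx Pcl)).
  by rewrite ul; apply: (posdefmx_congr_linv JJ).
have hQ := posdefmx_adj pQ; have uQ := posdefmx_unit pQ.
have := posdefmx_schur2 (ulsubmx Pcl + e%:M) 1%:M (ulsubmx (invmx Pcl)).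
rewrite adjmx1 mul1mx mulmx1 => sch; apply/sch; split; first exact: pQ.
set Q := ulsubmx (invmx Pcl) in hQ uQ *.
have QE : Q = J^t* *m invmx Pcl *m J by exact: ul.
(* [T] is what remains of [J] after [Pcl]-orthogonal projection onto the range of [Pcl^-1 J]; its
   own form under [Pcl] is [P - Q^-1]. *)
pose T := J - invmx Pcl *m J *m invmx Q.
have pT : psdmx (T^t* *m Pcl *m T) by exact/psdmx_congr/posdefmx_psd.
have JT : J^t* *m Pcl *m T = ulsubmx Pcl - invmx Q.
  rewrite /T mulmxBr -ul !mulmxA -[J^t* *m Pcl *m _]mulmxA (mulmxV uP) mulmx1.
  by rewrite JJ mul1mx.
have TE : T^t* *m Pcl *m T = ulsubmx Pcl - invmx Q.
  have TQ : (invmx Pcl *m J *m invmx Q)^t* *m Pcl *m T = 0.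
    rewrite !adjmxM !adjmx_inv hP hQ -!mulmxA [invmx Pcl *m _]mulmxA.
    rewrite (mulVmx uP) mul1mx /T mulmxBr JJ !mulmxA -QE.
    by rewrite (mulmxV uQ) subrr mulmx0.
  by rewrite {1}/T adjmxB mulmxBl mulmxBl TQ subr0.
have -> : ulsubmx Pcl + e%:M - invmx Q = e%:M + (ulsubmx Pcl - invmx Q).
  by rewrite [_ + e%:M]addrC addrA.
apply: posdefmxD_psd; first exact: posdefmx_scalar.
by rewrite -TE.
Qed.

End Embedding.

(** * The closed loop as an affine function of the controller, and the three programs in Schur
    complement form *)

Section ClosedLoop.
Context {R : realType} {n m p nu ny : nat} (G : plant R n m p nu ny).
Local Notation C := R[i].

Definition open_loop : 'M[C]_(n + p, n + m) :=
  block_mx (plA G) (plB1 G) (plC1 G) (plD11 G).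

Definition closed_loop nK (K : controller R nK nu ny) :
    'M[C]_(n + nK + p, n + nK + m) :=
  block_mx (Acl G K) (Bcl G K) (Ccl G K) (Dcl G K).

Lemma closed_loopE nK (K : controller R nK nu ny) :
  closed_loop K = embed n nK p *m open_loop *m (embed n nK m)^t*
    + (lift_kernel nK ((plB2 G)^t*) ((plD12 G)^t*))^t*
      *m block_mx (ctA K) (ctB K) (ctC K) (ctD K)
      *m lift_kernel nK (plC2 G) (plD21 G).
Proof.
rewrite adjmx_embed /embed /lift_kernel !adjmx_block !adjmx_row !trmxCK.
rewrite !adjmx0 !adjmx1 !mulmx_block.
rewrite !(mulmx0, mul0mx, mulmx1, mul1mx, addr0, add0r).
rewrite !mul_col_mx !mul_mx_row.
rewrite !(mulmx0, mul0mx, mulmx1, mul1mx, addr0, add0r).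
rewrite /closed_loop /Acl /Bcl /Ccl /Dcl /open_loop -block_mxEv !block_mxEh.
rewrite !add_col_mx !(addr0, add0r) !mul_col_mx !add_row_mx !(addr0, add0r).
by rewrite !add_col_mx !(addr0, add0r) !add_row_mx !add_col_mx !(addr0, add0r).
Qed.

Definition state_weight nK d (M : 'M[C]_(n + nK)) (D : 'M[C]_d) :
    'M[C]_(n + nK + d) := block_mx M 0 0 D.

Lemma closed_loop_gram nK (K : controller R nK nu ny) (Pcl : 'M[C]_(n + nK)) :
  (closed_loop K)^t* *m state_weight Pcl 1%:M *m closed_loop K =
  block_mx ((Acl G K)^t* *m Pcl *m Acl G K + (Ccl G K)^t* *m Ccl G K)
           ((Acl G K)^t* *m Pcl *m Bcl G K + (Ccl G K)^t* *m Dcl G K)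
           ((Bcl G K)^t* *m Pcl *m Acl G K + (Dcl G K)^t* *m Ccl G K)
           ((Bcl G K)^t* *m Pcl *m Bcl G K + (Dcl G K)^t* *m Dcl G K).
Proof.
rewrite /closed_loop /state_weight adjmx_block !mulmx_block.
by rewrite !(mulmx0, mulmx1, addr0, add0r).
Qed.

Lemma S_lmiP nK (K : controller R nK nu ny) (Pcl : 'M[C]_(n + nK))
    (g : gain R m) :
  S_feasible G K Pcl g <->
  [/\ posdefmx Pcl, gain_admissible g &
      posdefmx (state_weight Pcl (lamIY g) -
        (closed_loop K)^t* *m state_weight Pcl 1%:M *m closed_loop K)].
Proof.
rewrite /S_feasible /=; set M := (X in negdefmx X).
suff -> : M = - (state_weight Pcl (lamIY g) -
    (closed_loop K)^t* *m state_weight Pcl 1%:M *m closed_loop K).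
  split=> [[pP ga /negdefmxN]|[pP ga pS]]; first by rewrite opprK.
  by split=> //; apply/negdefmxN; rewrite opprK.
rewrite /M closed_loop_gram /state_weight opprB opp_block_mx !add_block_mx.
rewrite !oppr0 !addr0; congr block_mx; first by rewrite addrAC.
by rewrite addrAC.
Qed.

Lemma state_weight_posdef nK d (M : 'M[C]_(n + nK)) (D : 'M[C]_d) :
  posdefmx (state_weight M D) <-> posdefmx M /\ posdefmx D.
Proof. exact: posdefmx_diag_block. Qed.

Lemma state_weight_inv nK d (M : 'M[C]_(n + nK)) (D : 'M[C]_d) :
  posdefmx M -> posdefmx D ->
  invmx (state_weight M D) = state_weight (invmx M) (invmx D).
Proof. by move=> pM pD; apply: invmx_diag_block; exact: posdefmx_unit. Qed.

Lemma state_weight_inv1 nK d (M : 'M[C]_(n + nK)) : posdefmx M ->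
  invmx (state_weight M (1%:M : 'M_d)) = state_weight (invmx M) 1%:M.
Proof. by move=> pM; rewrite (state_weight_inv pM (posdefmx1 d)) invmx1. Qed.

(** Schur complement with respect to the upper-left block, the inverse of [H = diag(Pcl, I)]. For
    fixed [Pcl] the second program is thus (S), in a form affine in the controller. *)
Lemma K_lmiP nK (K : controller R nK nu ny) (Pcl : 'M[C]_(n + nK))
    (g : gain R m) : posdefmx Pcl ->
  K_feasible G Pcl K g <-> S_feasible G K Pcl g.
Proof.
move=> pP; rewrite S_lmiP /K_feasible /=.
have pH : posdefmx (state_weight Pcl (1%:M : 'M_p)).
  by apply/state_weight_posdef; split=> //; exact: posdefmx1.
have := posdefmx_schur1 (invmx (state_weight Pcl 1%:M)) (closed_loop K)
  (state_weight Pcl (lamIY g)).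
rewrite invmxK (state_weight_inv1 p pP) {1}/closed_loop adjmx_block => sch.
split=> [[ga /sch[_ ?]]|[_ ga pS]]; split=> //.
apply/sch; split; last exact: pS.
apply/state_weight_posdef; split; last exact: posdefmx1.
exact: posdefmx_inv.
Qed.

(** The primal and dual forms of the open-loop plant: what [embed] leaves of [L - M0^* H M0] and
    [H^-1 - M0 L^-1 M0^*]. *)
Definition reduced_primal (P : 'M[C]_n) (g : gain R m) : 'M[C]_(n + m) :=
  block_mx P 0 0 (lamIY g) - open_loop^t* *m block_mx P 0 0 1%:M *m open_loop.

Definition reduced_dual (Q : 'M[C]_n) (g : gain R m) : 'M[C]_(n + p) :=
  block_mx Q 0 0 1%:M -
    open_loop *m block_mx Q 0 0 (invmx (lamIY g)) *m open_loop^t*.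

(** Grouping the first two block rows and columns of each matrix gives the shape of [kernel_lmiP].
    The eliminated block is [lamIY g] in the inequality for [Q] and the identity in the one for
    [P]. *)
Lemma PQ_lmiP rc ro (Nc : 'M[C]_(n + p, rc)) (No : 'M[C]_(n + m, ro))
    (P Q : 'M[C]_n) (g : gain R m) :
  PQ_feasible G Nc No P Q g <->
  [/\ P \is hermsymmx /\ Q \is hermsymmx, gain_admissible g,
      posdefmx (block_mx P 1%:M 1%:M Q),
      posdefmx (lamIY g) /\ posdefmx (Nc^t* *m reduced_dual Q g *m Nc) &
      posdefmx (No^t* *m reduced_primal P g *m No)].
Proof.
pose F := col_mx (plB1 G) (plD11 G).
pose Yc := block_mx Q 0 0 1%:M -
  col_mx (plA G) (plC1 G) *m Q *m (col_mx (plA G) (plC1 G))^t*.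
pose F' := (row_mx (plC1 G) (plD11 G))^t*.
pose Yo := block_mx P 0 0 (lamIY g) -
  (row_mx (plA G) (plB1 G))^t* *m P *m (row_mx (plA G) (plB1 G)).
have Ec : block_mx3
    (plA G *m Q *m (plA G)^t* - Q) (plA G *m Q *m (plC1 G)^t*) (plB1 G)
    (plC1 G *m Q *m (plA G)^t*) (plC1 G *m Q *m (plC1 G)^t* - 1%:M) (plD11 G)
    ((plB1 G)^t*) ((plD11 G)^t*) (- lamIY g)
    = block_mx (- Yc) F (F^t*) (- lamIY g).
  rewrite /block_mx3 /F /Yc; congr block_mx; last by rewrite adjmx_col.
  rewrite opprB adjmx_col mul_col_mx mul_col_row opp_block_mx add_block_mx.
  by rewrite !oppr0 !addr0.
have Eo : block_mx3
    ((plA G)^t* *m P *m plA G - P) ((plA G)^t* *m P *m plB1 G) ((plC1 G)^t*)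
    ((plB1 G)^t* *m P *m plA G) ((plB1 G)^t* *m P *m plB1 G - lamIY g)
    ((plD11 G)^t*)
    (plC1 G) (plD11 G) (- 1%:M)
    = block_mx (- Yo) F' (F'^t*) (- 1%:M).
  rewrite /block_mx3 /F' /Yo trmxCK !adjmx_row; congr block_mx.
  rewrite opprB mul_col_mx mul_col_row opp_block_mx add_block_mx.
  by rewrite !oppr0 !addr0.
have Rc : reduced_dual Q g = Yc - F *m invmx (lamIY g) *m F^t*.
  have -> : reduced_dual Q g = block_mx Q 0 0 1%:M
      - row_mx (col_mx (plA G) (plC1 G)) F
      *m block_mx Q 0 0 (invmx (lamIY g))
      *m (row_mx (col_mx (plA G) (plC1 G)) F)^t*.
    by rewrite /reduced_dual /open_loop [block_mx (plA G) _ _ _]block_mxEh.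
  rewrite /Yc -addrA -opprD adjmx_row.
  by rewrite mul_row_block !mulmx0 addr0 add0r mul_row_col.
have Ro : reduced_primal P g = Yo - F' *m invmx 1%:M *m F'^t*.
  have -> : reduced_primal P g = block_mx P 0 0 (lamIY g)
      - (col_mx (row_mx (plA G) (plB1 G)) (row_mx (plC1 G) (plD11 G)))^t*
      *m block_mx P 0 0 1%:M
      *m col_mx (row_mx (plA G) (plB1 G)) (row_mx (plC1 G) (plD11 G)).
    by rewrite /reduced_primal /open_loop [block_mx (plA G) _ _ _]block_mxEv.
  rewrite /Yo -addrA -opprD adjmx_col.
  rewrite mul_row_block !mulmx0 addr0 add0r mul_row_col.
  by rewrite /F' invmx1 trmxCK.
rewrite /PQ_feasible /= Ec Eo Rc Ro; split=> -[h1 h2 h3 h4 h5].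
  split; [exact: h1 | exact: h2 | exact: h3 | exact/kernel_lmiP |].
  by have [_] := (kernel_lmiP _ _ _ _).1 h5.
split; [exact: h1 | exact: h2 | exact: h3 | exact/kernel_lmiP |].
by apply/kernel_lmiP; split; [exact: posdefmx1 | exact: h5].
Qed.

(** * Compression of the closed-loop forms to the plant coordinates *)

Section Reduction.
Context {nK : nat} (Pcl : 'M[C]_(n + nK)) (g : gain R m).
Context (pP : posdefmx Pcl) (pLam : posdefmx (lamIY g)).

Let M0 : 'M[C]_(n + nK + p, n + nK + m) :=
  embed n nK p *m open_loop *m (embed n nK m)^t*.

Let M0_embed : M0 *m embed n nK m = embed n nK p *m open_loop.
Proof. by rewrite /M0 -mulmxA embedK mulmx1. Qed.

Let adj_M0 : M0^t* = embed n nK m *m open_loop^t* *m (embed n nK p)^t*.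
Proof. by rewrite /M0 !adjmxM trmxCK mulmxA. Qed.

Let M0_adj_embed : M0^t* *m embed n nK p = embed n nK m *m open_loop^t*.
Proof. by rewrite adj_M0 -[_ *m _^t* *m _]mulmxA embedK mulmx1. Qed.

Lemma embed_primal :
  (embed n nK m)^t* *m
    (state_weight Pcl (lamIY g) - M0^t* *m state_weight Pcl 1%:M *m M0)
    *m embed n nK m = reduced_primal (ulsubmx Pcl) g.
Proof.
rewrite mulmxBr mulmxBl embed_diag /reduced_primal; congr (_ - _).
by rewrite -adjmx_congrM M0_embed adjmx_congrM embed_diag.
Qed.

(** The dual form contains [Pcl^-1], so its compression sees the upper-left block of the inverse;
    this block plays the role of [Q]. *)
Lemma embed_dual :
  (embed n nK p)^t* *m
    (invmx (state_weight Pcl 1%:M)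
     - M0 *m invmx (state_weight Pcl (lamIY g)) *m M0^t*)
    *m embed n nK p = reduced_dual (ulsubmx (invmx Pcl)) g.
Proof.
rewrite (state_weight_inv1 p pP) (state_weight_inv pP pLam).
rewrite mulmxBr mulmxBl embed_diag /reduced_dual; congr (_ - _).
set J' := embed n nK p; set L := state_weight _ _.
have -> : J'^t* *m (M0 *m L *m M0^t*) *m J' =
    (M0^t* *m J')^t* *m L *m (M0^t* *m J').
  by rewrite [(M0^t* *m J')^t*]adjmxM trmxCK !mulmxA.
rewrite M0_adj_embed; set J := embed n nK m.
have -> : (J *m open_loop^t*)^t* *m L *m (J *m open_loop^t*) =
    open_loop *m (J^t* *m L *m J) *m open_loop^t*.
  by rewrite [(J *m _)^t*]adjmxM trmxCK !mulmxA.
by rewrite embed_diag.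
Qed.

End Reduction.
(** On each kernel the closed loop coincides with [M0], so the two restricted forms no longer
    involve the controller. *)
Lemma PQ_necessary nK rc ro (Nc : 'M[C]_(n + p, rc)) (No : 'M[C]_(n + m, ro))
    (K : controller R nK nu ny) (Pcl : 'M[C]_(n + nK)) (g : gain R m) :
  orthonormal_kernel (row_mx ((plB2 G)^t*) ((plD12 G)^t*)) Nc ->
  orthonormal_kernel (row_mx (plC2 G) (plD21 G)) No ->
  S_feasible G K Pcl g ->
  exists P Q : 'M[C]_n, PQ_feasible G Nc No P Q g.
Proof.
move=> kNc kNo /S_lmiP [pP ga pS].
have kF := orthonormal_kernel_embed nK kNc.
have kE := orthonormal_kernel_embed nK kNo.
have pH : posdefmx (state_weight Pcl (1%:M : 'M_p)).
  by apply/state_weight_posdef; split; [exact: pP | exact: posdefmx1].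
have uH := posdefmx_unit pH.
have pHi := posdefmx_inv pH.
have [pL pD] : posdefmx (state_weight Pcl (lamIY g)) /\
    posdefmx (invmx (state_weight Pcl 1%:M)
      - closed_loop K *m invmx (state_weight Pcl (lamIY g))
        *m (closed_loop K)^t*).
  by apply/(posdefmx_schur_swap _ _ pHi); rewrite invmxK.
have pLam : posdefmx (lamIY g) by have [_] := (state_weight_posdef _ _).1 pL.
have pc : posdefmx (Nc^t* *m reduced_dual (ulsubmx (invmx Pcl)) g *m Nc).
  have := posdefmx_congr_linv kF.1 pD.
  rewrite mulmxBr mulmxBl.
  set X := closed_loop K; set F := embed n nK p *m Nc.
  set L := invmx (state_weight Pcl (lamIY g)).
  set M0 := embed n nK p *m open_loop *m (embed n nK m)^t*.
  have XF : X^t* *m F = M0^t* *m F.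
    have F0 : lift_kernel nK ((plB2 G)^t*) ((plD12 G)^t*) *m F = 0.
      exact: orthonormal_kernel_mul0 kF.
    rewrite /X closed_loopE adjmxD mulmxDl -/M0 -[RHS]addr0; congr (_ + _).
    by rewrite 2!adjmxM trmxCK -!mulmxA F0 !mulmx0.
  have -> : F^t* *m (X *m L *m X^t*) *m F = (X^t* *m F)^t* *m L *m (X^t* *m F).
    by rewrite [(X^t* *m F)^t*]adjmxM trmxCK !mulmxA.
  rewrite XF.
  have -> : (M0^t* *m F)^t* *m L *m (M0^t* *m F) =
      F^t* *m (M0 *m L *m M0^t*) *m F.
    by rewrite [(M0^t* *m F)^t*]adjmxM trmxCK !mulmxA.
  rewrite -mulmxBl -mulmxBr -(embed_dual pP pLam).
  by rewrite -adjmx_congrM.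
have po : posdefmx (No^t* *m reduced_primal (ulsubmx Pcl) g *m No).
  have := posdefmx_congr_linv kE.1 pS.
  rewrite mulmxBr mulmxBl.
  set X := closed_loop K; set E := embed n nK m *m No.
  set H := state_weight Pcl 1%:M.
  set M0 := embed n nK p *m open_loop *m (embed n nK m)^t*.
  have XE : X *m E = M0 *m E.
    have E0 : lift_kernel nK (plC2 G) (plD21 G) *m E = 0.
      exact: orthonormal_kernel_mul0 kE.
    rewrite /X closed_loopE mulmxDl -/M0 -[RHS]addr0; congr (_ + _).
    by rewrite -!mulmxA E0 !mulmx0.
  rewrite -[X in _ - X]adjmx_congrM XE [X in _ - X]adjmx_congrM -mulmxBl -mulmxBr.
  by rewrite -(embed_primal Pcl g) -adjmx_congrM.
(* [reduced_primal] is affine in [P], with derivative [N] along [1%:M]. *)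
pose N := block_mx (1%:M : 'M[C]_n) 0 0 0 -
  open_loop^t* *m block_mx (1%:M : 'M[C]_n) 0 0 0 *m open_loop.
have hN : No^t* *m N *m No \is hermsymmx.
  have hD d : block_mx (1%:M : 'M[C]_n) 0 0 (0 : 'M_d) \is hermsymmx.
    by apply/hermsymmxP; rewrite adjmx_block adjmx1 !adjmx0.
  apply: hermsymmx_congr; apply: hermsymmxB; first exact: hD.
  exact/hermsymmx_congr/hD.
(* [e] only has to be small for the primal inequality: any positive shift makes the coupling of [P]
   and [Q] strict, and the dual inequality does not involve [P]. *)
have [e e0 /(_ e e0 (lexx e)) pe] := posdefmx_open po hN.
exists (ulsubmx Pcl + e%:M), (ulsubmx (invmx Pcl)).
have hul (M : 'M[C]_(n + nK)) : posdefmx M -> ulsubmx M \is hermsymmx.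
  move=> /posdefmx_adj hM; apply/hermsymmxP.
  by rewrite -[M in RHS]hM; apply/matrixP => i j; rewrite !mxE.
apply/PQ_lmiP; split.
- split; last exact/hul/posdefmx_inv.
  apply/hermsymmxP; rewrite adjmxD (hermsymmxP _ (hul _ pP)) adjmx_scalar.
  by rewrite (CrealP (gtr0_real e0)).
- exact: ga.
- exact: posdefmx_ulsubmx_inv.
- by split.
- have -> : reduced_primal (ulsubmx Pcl + e%:M) g =
      reduced_primal (ulsubmx Pcl) g + e *: N.
    have bD d (D : 'M[C]_d) : block_mx (ulsubmx Pcl + e%:M) 0 0 D =
        block_mx (ulsubmx Pcl) 0 0 D + e *: block_mx 1%:M 0 0 0.
      rewrite scale_block_mx add_block_mx !scaler0 !addr0.
      by rewrite scalemx1.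
    rewrite /reduced_primal !bD mulmxDr mulmxDl -scalemxAr -scalemxAl /N.
    by rewrite scalerBr opprD addrACA.
  by rewrite mulmxDr mulmxDl -scalemxAr -scalemxAl.
Qed.

End ClosedLoop.

(** The condition on [P2] makes [P] and [Q] the upper-left blocks of [Pcl] and [Pcl^-1], so the
    inequalities of (PQ) are exactly the hypotheses of [strict_parrott]. *)
Lemma PQ_sufficient (R : realType) (n m p nu ny nK rc ro : nat)
    (G : plant R n m p nu ny) (Nc : 'M[R[i]]_(n + p, rc))
    (No : 'M[R[i]]_(n + m, ro)) (P Q : 'M[R[i]]_n) (g : gain R m)
    (P2 : 'M[R[i]]_(nK, n)) :
  orthonormal_kernel (row_mx ((plB2 G)^t*) ((plD12 G)^t*)) Nc ->
  orthonormal_kernel (row_mx (plC2 G) (plD21 G)) No ->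
  PQ_feasible G Nc No P Q g -> P - invmx Q = P2^t* *m P2 ->
  posdefmx (make_Pcl P P2) /\
  exists K : controller R nK nu ny, K_feasible G (make_Pcl P P2) K g.
Proof.
move=> kNc kNo /PQ_lmiP [[hP hQ] ga pPQ [pLam pc] po] PQ2.
have pQ : posdefmx Q.
  by have := posdefmx_schur2 P 1%:M Q; rewrite adjmx1 => sch; case: (sch.1 pPQ).
have uQ := posdefmx_unit pQ.
have PP2 : P - P2^t* *m P2 = invmx Q by rewrite -PQ2 opprB addrC subrK.
have pPcl : posdefmx (make_Pcl P P2).
  have := posdefmx_schur2 P (P2^t*) (1%:M : 'M_nK).
  rewrite trmxCK invmx1 mulmx1 PP2 => sch; apply/sch; split.
    exact: posdefmx1.
  exact: posdefmx_inv.
split; first exact: pPcl.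
have ulP : ulsubmx (make_Pcl P P2) = P by rewrite block_mxKul.
have ulQ : ulsubmx (invmx (make_Pcl P P2)) = Q.
  have uP := posdefmx_unit pPcl.
  (* This identity exhibits the first block column of [Pcl^-1]. *)
  have e1 : make_Pcl P P2 *m col_mx Q (- (P2 *m Q)) = col_mx 1%:M 0.
    rewrite mul_block_col mulmxN mul1mx subrr mulmxA -mulmxBl PP2.
    by rewrite (mulVmx uQ).
  have e2 : lsubmx (invmx (make_Pcl P P2)) = col_mx Q (- (P2 *m Q)).
    rewrite -[RHS]mul1mx -(mulVmx uP) -[RHS]mulmxA e1.
    rewrite -[invmx _ in RHS]hsubmxK mul_row_col mulmx1 mulmx0 addr0.
    by [].
  have -> (M : 'M[R[i]]_(n + nK)) : ulsubmx M = usubmx (lsubmx M).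
    by apply/matrixP => i j; rewrite !mxE.
  by rewrite e2 col_mxKu.
have kF := orthonormal_kernel_embed nK kNc.
have kE := orthonormal_kernel_embed nK kNo.
rewrite -[lift_kernel _ _ _]trmxCK in kF.
have pH : posdefmx (state_weight (make_Pcl P P2) (1%:M : 'M_p)).
  by apply/state_weight_posdef; split; [exact: pPcl | exact: posdefmx1].
have pL : posdefmx (state_weight (make_Pcl P P2) (lamIY g)).
  by apply/state_weight_posdef; split; [exact: pPcl | exact: pLam].
have [||Th pTh] := strict_parrott
  (M0 := embed n nK p *m open_loop G *m (embed n nK m)^t*) pH pL kF kE.
- by rewrite adjmx_congrM (embed_dual _ pPcl pLam) ulQ.
- by rewrite adjmx_congrM embed_primal ulP.
exists (Controller (ulsubmx Th) (ursubmx Th) (dlsubmx Th) (drsubmx Th)).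
apply/(K_lmiP _ _ _ pPcl)/S_lmiP; split; [exact: pPcl | exact: ga |].
by rewrite closed_loopE submxK.
Qed.

(** The Stein inequality gives a strict margin in the state block, scaling makes that margin absorb
    [Ccl^* Ccl], and a large [lambda] handles the disturbance block. The order is that of the
    stabilizing controller. *)
Lemma stabilizable_S_feasible (R : realType) (n m p nu ny : nat)
    (G : plant R n m p nu ny) : stabilizable G ->
  exists (nK : nat) (K : controller R nK nu ny) (Pcl : 'M[R[i]]_(n + nK))
    (g : gain R m), S_feasible G K Pcl g.
Proof.
move=> [nK [K /stein [P0 pP0 pS0]]]; exists nK, K.
have hC : - ((Ccl G K)^t* *m Ccl G K) \is hermsymmx.
  by apply/hermsymmxP; rewrite adjmxN adjmxM trmxCK.
have [e e0 /(_ e e0 (lexx e)) pe] := posdefmx_open pS0 hC.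
(* Rescaling by [f = 1/e] turns the tolerated multiple [e] of [Ccl^* Ccl] into exactly one copy. *)
have [f f0 fe] : exists2 f : R[i], 0 < f & f * e = 1.
  by exists e^-1; rewrite ?invr_gt0 // mulVf // gt_eqF.
have [P PE] : exists P : 'M[R[i]]_(n + nK), P = f *: P0 by eexists.
have pP : posdefmx P by rewrite PE; exact: posdefmxZ f0 pP0.
have [S SE] : exists S : 'M[R[i]]_(n + nK),
    S = P - ((Acl G K)^t* *m P *m Acl G K
    + (Ccl G K)^t* *m Ccl G K) by eexists.
have pS : posdefmx S.
  have -> : S = f *: (P0 - (Acl G K)^t* *m P0 *m Acl G K
      + e *: (- ((Ccl G K)^t* *m Ccl G K))).
    rewrite SE PE scalerDr scalerA fe scale1r scalerBr.
    by rewrite -scalemxAr -scalemxAl opprD addrA.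
  exact: posdefmxZ f0 pe.
have [B BE] : exists B : 'M[R[i]]_(n + nK, m),
    B = - ((Acl G K)^t* *m P *m Bcl G K
    + (Ccl G K)^t* *m Dcl G K) by eexists.
have BEh : B^t* = - ((Bcl G K)^t* *m P *m Acl G K + (Dcl G K)^t* *m Ccl G K).
  by rewrite BE adjmxN adjmxD !adjmxM !trmxCK (posdefmx_adj pP) mulmxA.
have [N NE] : exists N : 'M[R[i]]_m, N = (Bcl G K)^t* *m P *m Bcl G K
    + (Dcl G K)^t* *m Dcl G K + B^t* *m invmx S *m B by eexists.
have [hN _] : psdmx N.
  rewrite NE; apply: psdmxD; first apply: psdmxD.
  - exact/psdmx_congr/posdefmx_psd.
  - exact: psdmx_gram.
  - exact/psdmx_congr/posdefmx_psd/posdefmx_inv.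
have [c c0 pc] := hermsymmx_ubound hN.
have [r cE] : exists r : R, c = r%:C by apply/complex_realP/ger0_real.
move: c0 pc; rewrite {}cE ler0c => r0 pr.
(* With [Y = 0] and [t = 0], the real [r] bounds [N], and the extra 1 leaves at least the identity
   as Schur complement. *)
pose g : gain R m := Gain 0 (r + 1) 0.
exists P, g; apply/S_lmiP; split; first exact: pP.
  split=> /=.
  - by apply/hermsymmxP; rewrite adjmx0.
  - by move=> i j; rewrite mxE normr0 lexx.
  - exact: lexx.
  - by rewrite addr_ge0.
rewrite closed_loop_gram /state_weight opp_block_mx add_block_mx !add0r.
rewrite -SE -BE -BEh.
apply/posdefmx_schur1; split; first exact: pS.
have -> : lamIY g - ((Bcl G K)^t* *m P *m Bcl G K + (Dcl G K)^t* *m Dcl G K)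
    - B^t* *m invmx S *m B = 1%:M + (r%:C%:M - N).
  rewrite -addrA -opprD -NE /lamIY /= addr0 rmorphD /= raddfD /=.
  by rewrite addrAC addrC.
by apply: posdefmxD_psd; [exact: posdefmx1 | exact: pr].
Qed.

(** * Equality of the optimal values and tolerances of the two-stage procedure *)

Theorem mainTheorem3 (R : realType) (n m p nu ny nK k rc ro : nat)
    (G : plant R n m p nu ny)
    (Nc : 'M[R[i]]_(n + p, rc)) (No : 'M[R[i]]_(n + m, ro))
    (stabG : stabilizable G) (k_ge1 : (1 <= k)%N) (n_le_nK : (n <= nK)%N)
    (NcP : orthonormal_kernel (row_mx ((plB2 G)^t*) ((plD12 G)^t*)) Nc)
    (NoP : orthonormal_kernel (row_mx (plC2 G) (plD21 G)) No) :
  let S := S_program G (nK := nK) in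
  let PQ := PQ_program G Nc No in
  let optS := opt_value S (fun x => cost k x.2) in
  let optPQ := opt_value PQ (fun x => cost k x.2) in
  [/\ S !=set0, PQ !=set0, optS = optPQ &
      forall (eps : R) (P Q : 'M[R[i]]_n) (g : gain R m),
        0 <= eps ->
        minimizer_upto eps PQ (fun x => cost k x.2) (P, Q, g) ->
        (exists P2 : 'M[R[i]]_(nK, n), P - invmx Q = P2^t* *m P2) /\
        forall P2 : 'M[R[i]]_(nK, n), P - invmx Q = P2^t* *m P2 ->
          let Pcl := make_Pcl P P2 in
          let SDP2 := K_program G Pcl in
          let optSDP2 := opt_value SDP2 (fun x => cost k x.2) in
          [/\ posdefmx Pcl,
              exists K : controller R nK nu ny, SDP2 (K, g),
              optPQ <= optSDP2 <= optPQ + eps &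
              forall (delta : R) (K : controller R nK nu ny) (g' : gain R m),
                0 <= delta ->
                minimizer_upto delta SDP2 (fun x => cost k x.2) (K, g') ->
                cost k g' <= optPQ + eps + delta /\
                minimizer_upto (eps + delta) S (fun x => cost k x.2)
                  (K, Pcl, g')]].
Proof.
move=> S PQ optS optPQ.
have costge0 g : gain_admissible g -> 0 <= cost k g.
  by case=> _ _ t0 l0; rewrite addr_ge0 // mulr_ge0 ?ler0n.
have S_to_PQ x : S x -> exists2 y, PQ y & cost k y.2 = cost k x.2.
  by move=> /(PQ_necessary NcP NoP) [P [Q PQf]]; exists (P, Q, x.2).
have factor P Q g : PQ_feasible G Nc No P Q g ->
    exists P2 : 'M[R[i]]_(nK, n), P - invmx Q = P2^t* *m P2.
  case=> _ _ pPQ _ _; apply: (posdefmx_factor n_le_nK).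
  have := posdefmx_schur2 P 1%:M Q; rewrite adjmx1 mul1mx mulmx1 => sch.
  by case: (sch.1 pPQ).
have PQ_to_S y : PQ y -> exists2 x, S x & cost k x.2 = cost k y.2.
  case: y => [[P Q] g] PQf; have [P2 P2E] := factor _ _ _ PQf.
  have [pP [K /(K_lmiP _ _ _ pP) Kf]] := PQ_sufficient NcP NoP PQf P2E.
  by exists (K, make_Pcl P P2, g).
(* The stabilizing controller may have an order other than [nK]; (PQ) does not depend on the order,
   so passing through it makes (S) feasible at order [nK]. *)
have PQ0 : PQ !=set0.
  have [nK' [K [Pcl [g Sf]]]] := stabilizable_S_feasible stabG.
  by have [P [Q PQf]] := PQ_necessary NcP NoP Sf; exists (P, Q, g).
have S0 : S !=set0 by have [y /PQ_to_S [x Sx _]] := PQ0; exists x.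
(* Both programs attain the same set of costs, so the infima agree without being attained. *)
have optE : optS = optPQ.
  rewrite /optS /optPQ /opt_value; congr inf; apply/seteqP; split=> _ [x Fx <-].
    by have [y Fy <-] := S_to_PQ _ Fx; exists y.
  by have [y Fy <-] := PQ_to_S _ Fx; exists y.
have optS_le x : S x -> optS <= cost k x.2.
  move=> Sx; apply: ge_inf; last by exists x.
  exists 0 => _ [z Sz <-]; apply: costge0.
  by case: Sz.
split=> // eps P Q g eps0 [PQf gmin]; split; first exact: factor PQf.
move=> P2 P2E Pcl SDP2 optSDP2.
have [pP [K Kf]] := PQ_sufficient NcP NoP PQf P2E.
have SDP2_S x : SDP2 x -> S (x.1, Pcl, x.2) by move=> /(K_lmiP _ _ _ pP).
have SDP2_le x : SDP2 x -> optPQ <= cost k x.2.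
  by move=> /SDP2_S /optS_le; rewrite optE.
(* [optPQ] is the greatest lower bound of a nonempty set of costs, and [cost k g - eps] is a lower
   bound of it. *)
have g_le : cost k g <= optPQ + eps.
  rewrite -lerBlDr; apply: lb_le_inf.
    by have [y Fy] := PQ0; exists (cost k y.2); exists y.
  by move=> _ [y Fy <-]; rewrite lerBlDr; exact: gmin.
split; [exact: pP | by exists K | apply/andP; split |].
- apply: lb_le_inf; first by exists (cost k g); exists (K, g).
  by move=> _ [x Fx <-]; exact: SDP2_le.
- apply: le_trans g_le; apply: ge_inf; last by exists (K, g).
  by exists optPQ => _ [x Fx <-]; exact: SDP2_le.
(* The pair [(K, g)] is feasible for the second program, so a minimizer up to [delta] costs at most
   [cost k g + delta]; the tolerances add up. *)
move=> delta K' g' delta0 [Ff' fmin].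
have g'_le : cost k g' <= optPQ + eps + delta.
  by apply: le_trans (fmin (K, g) Kf) _; rewrite lerD2r.
split; first exact: g'_le.
split; first exact: (SDP2_S (K', g')).
move=> y Sy; apply: le_trans g'_le _; rewrite -addrA lerD2r -optE.
exact: optS_le.
Qed.
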